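(* Let $s\in\mathbb{N}$ be fixed. The $3$-Uniform Hypergraph $2$-Coloring Problem, the $3$-Uniform Hypergraph $2$-Precoloring Extension Problem, and the $3$-Uniform Hypergraph Maximum Stable Set Problem, each restricted to linear $M_s$-free hypergraphs, are polynomial-time solvable.
   Context: A hypergraph $G=(V,E)$ consists of a finite vertex set $V=V(G)$ and an edge set $E=E(G)\subseteq 2^{V}\setminus\{\emptyset\}$. It is $3$-uniform if $|e|=3$ for all $e\in E$, and linear if $|e\cap e'|\le 1$ for every two distinct $e,e'\in E(G)$. For $X\subseteq V(G)$, the induced subhypergraph is $G[X]=(X,\{e\in E(G): e\subseteq X\})$. $M_s$ denotes the $3$-uniform hypergraph with $3s$ vertices and $s$ pairwise disjoint edges (and no other edges). $G$ is $M_s$-free if no induced subhypergraph of $G$ is isomorphic to $M_s$. A set $S\subseteq V(G)$ is stable if no edge $e$ satisfies $e\subseteq S$. A $2$-coloring of $G$ is a function $c:V(G)\to\{1,2\}$ with $c^{-1}(1)$, $c^{-1}(2)$ both stable. A partial $2$-coloring $(X,c)$ of $G$ is a set $X\subseteq V(G)$ with a $2$-coloring $c$ of $G[X]$; it $2$-extends to $G$ if some $2$-coloring $c'$ of $G$ satisfies $c'|_X=c$. The $3$-Uniform Hypergraph $2$-Coloring Problem: given a $3$-uniform hypergraph $G$, decide whether $G$ has a $2$-coloring. The $3$-Uniform Hypergraph $2$-Precoloring Extension Problem: given a $3$-uniform hypergraph $G$ and a partial $2$-coloring $(X,c)$ of $G$, decide whether $(X,c)$ $2$-extends to $G$. The $3$-Uniform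 Hypergraph Maximum Stable Set Problem: given a $3$-uniform hypergraph $G$, compute a stable set of $G$ of maximum cardinality. *)

(* Defs.v *)
From mathcomp Require Import all_boot all_order all_algebra.

Set Implicit Arguments.
Unset Strict Implicit.
Unset Printing Implicit Defensive.

(** * Hypergraphs *)

Record hypergraph := Hypergraph {
  vertex :> finType;
  edges : {set {set vertex}};
  edges_neq0 : set0 \notin edges }.

Definition three_uniform (G : hypergraph) : Prop :=
  forall e, e \in edges G -> #|e| = 3.

Definition linear_hg (G : hypergraph) : Prop :=
  forall e e', e \in edges G -> e' \in edges G -> e != e' ->
    #|e :&: e'| <= 1.

Definition induced_edges (G : hypergraph) (X : {set G}) :
    {set {set {x : G | x \in X}}} :=
  [set e : {set {x : G | x \in X}} | [set val x | x in e] \in edges G].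

Lemma induced_edges_neq0 (G : hypergraph) (X : {set G}) :
  set0 \notin induced_edges X.
Proof. by rewrite inE imset0 edges_neq0. Qed.

(* The vertices of [G[X]] form the subtype of [G] cut out by [X]; its edges
   are in bijection, through [val], with the edges of [G] contained in [X]. *)
Definition induced (G : hypergraph) (X : {set G}) : hypergraph :=
  Hypergraph (induced_edges_neq0 X).

Definition isomorphic (G H : hypergraph) : Prop :=
  exists2 f : G -> H, bijective f &
    forall e : {set G}, (e \in edges G) = ([set f x | x in e] \in edges H).

Definition matching_edges (s : nat) : {set {set 'I_s * 'I_3}} :=
  [set [set (i, j) | j : 'I_3] | i : 'I_s].

Lemma matching_edges_neq0 (s : nat) : set0 \notin matching_edges s.
Proof.
apply/imsetP => -[i _ /setP /(_ (i, ord0))].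
by rewrite inE imset_f.
Qed.

Definition matching (s : nat) : hypergraph :=
  Hypergraph (matching_edges_neq0 s).

Definition matching_free (s : nat) (G : hypergraph) : Prop :=
  forall X : {set G}, ~ isomorphic (induced X) (matching s).

Definition stable (G : hypergraph) (S : {set G}) : Prop :=
  forall e, e \in edges G -> ~~ (e \subset S).

Definition max_stable (G : hypergraph) (S : {set G}) : Prop :=
  stable S /\ forall S' : {set G}, stable S' -> #|S'| <= #|S|.

(* The two colors 1 and 2 are the booleans [true] and [false]. *)
Definition two_coloring (G : hypergraph) (c : G -> bool) : Prop :=
  forall b : bool, stable [set v | c v == b].

Definition two_colorable (G : hypergraph) : Prop :=
  exists c : G -> bool, two_coloring c.

Definition two_extends (G : hypergraph) (X : {set G}) (c : induced X -> bool)
    : Prop :=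
  exists2 c' : G -> bool, two_coloring c' & forall x, c' (val x) = c x.

(** * Random access machines

    A program manipulates finitely many registers and an unbounded memory, all
    holding natural numbers.  Every elementary instruction and every test has
    unit cost.  There is no multiplication, so that [t] steps only create
    numbers with [O(t)] more bits than the input, and time on this machine is
    polynomially related to time on a Turing machine. *)

Inductive program :=
| Skip
| Const of nat & nat               (* r_i := k *)
| Add of nat & nat & nat           (* r_i := r_j + r_k *)
| Sub of nat & nat & nat           (* r_i := r_j - r_k, truncated at 0 *)
| Read of nat & nat                (* r_i := mem[r_j] *)
| Write of nat & nat               (* mem[r_i] := r_j *)
| Seq of program & program
| If of nat & program & program    (* if r_i <> 0 then _ else _ *)
| While of nat & program.          (* while r_i <> 0 do _ *)

Record state := State { reg : nat -> nat; mem : nat -> nat }.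

Definition update (f : nat -> nat) (i v : nat) : nat -> nat :=
  fun j => if j == i then v else f j.

Definition set_reg (st : state) (i v : nat) : state :=
  State (update (reg st) i v) (mem st).

Definition set_mem (st : state) (a v : nat) : state :=
  State (reg st) (update (mem st) a v).

(* [exec p st t st']: started in state [st], the program [p] halts after
   exactly [t] steps, in state [st']. *)
Inductive exec : program -> state -> nat -> state -> Prop :=
| exec_skip st : exec Skip st 1 st
| exec_const st i k : exec (Const i k) st 1 (set_reg st i k)
| exec_add st i j k :
    exec (Add i j k) st 1 (set_reg st i (reg st j + reg st k))
| exec_sub st i j k :
    exec (Sub i j k) st 1 (set_reg st i (reg st j - reg st k))
| exec_read st i j : exec (Read i j) st 1 (set_reg st i (mem st (reg st j)))
| exec_write st i j : exec (Write i j) st 1 (set_mem st (reg st i) (reg st j))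
| exec_seq p q st st' st'' t t' :
    exec p st t st' -> exec q st' t' st'' -> exec (Seq p q) st (t + t') st''
| exec_if_true i p q st st' t :
    reg st i != 0 -> exec p st t st' -> exec (If i p q) st t.+1 st'
| exec_if_false i p q st st' t :
    reg st i = 0 -> exec q st t st' -> exec (If i p q) st t.+1 st'
| exec_while_stop i p st : reg st i = 0 -> exec (While i p) st 1 st
| exec_while_loop i p st st' st'' t t' :
    reg st i != 0 -> exec p st t st' -> exec (While i p) st' t' st'' ->
    exec (While i p) st (t + t').+1 st''.

(* The input word is in memory from address 0, and its length in register 0;
   all other cells and registers are null. The output is read likewise. *)
Definition init (w : seq bool) : state :=
  State (update (fun=> 0) 0 (size w)) (fun a => nth false w a).

Definition output (st : state) : seq bool :=
  mkseq (fun a => mem st a != 0) (reg st 0).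

(** * Problems and polynomial time *)

Record problem := Problem {
  instance : Type;
  encode : instance -> seq bool;
  answer : instance -> seq bool -> Prop }.

(* The problem [P] restricted to the instances that satisfy [C]. *)
Definition poly_time_solvable (P : problem) (C : instance P -> Prop) : Prop :=
  exists (p : program) (q : {poly nat}), forall x : instance P, C x ->
    exists (t : nat) (st : state),
      [/\ exec p (init (encode x)) t st,
          t <= (q.[size (encode x)])%R
        & answer x (output st)].

Definition yes_no (A : Prop) (w : seq bool) : Prop :=
  exists b : bool, w = [:: b] /\ (b <-> A).

(* A 3-uniform hypergraph as an input: its vertices and its edges are listed
   without repetition, in an arbitrary order. *)
Record input3 := Input3 {
  hg :> hypergraph;
  hg_three_uniform : three_uniform hg;
  vertex_list : seq hg;
  vertex_listP : perm_eq vertex_list (enum [set: hg]);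
  edge_list : seq {set hg};
  edge_listP : perm_eq edge_list (enum (edges hg)) }.

(* A subset of the vertices as a word of length [#|G|]. *)
Definition encode_set (G : input3) (S : {set G}) : seq bool :=
  [seq v \in S | v <- vertex_list G].

Definition encode_order (G : input3) : seq bool :=
  rcons (nseq #|{: G}| true) false.

Definition encode_edges (G : input3) : seq bool :=
  flatten [seq encode_set e | e <- edge_list G].

Definition coloring_problem : problem := {|
  instance := input3;
  encode G := encode_order G ++ encode_edges G;
  answer G := yes_no (two_colorable G) |}.

Record precolored_input3 := PrecoloredInput3 {
  input :> input3;
  precolored : {set input};
  precoloring : induced precolored -> bool;
  precoloringP : two_coloring precoloring }.

Definition precoloring_problem : problem := {|
  instance := precolored_input3;
  encode G := encode_order G ++ encode_set (precolored G)
    ++ encode_set [set val x | x in @precoloring G] ++ encode_edges G;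
  answer G := yes_no (two_extends (@precoloring G)) |}.

Definition max_stable_set_problem : problem := {|
  instance := input3;
  encode G := encode_order G ++ encode_edges G;
  answer G w := exists2 S : {set G}, max_stable S & w = encode_set S |}.

(* Main.v *)
Require Import Defs.
From mathcomp Require Import all_boot all_order all_algebra.
From mathcomp Require Import zify.

Set Implicit Arguments.
Unset Strict Implicit.
Unset Printing Implicit Defensive.

(** In a linear 3-uniform hypergraph, an edge contained in the union of a
    matching either belongs to it or meets three of its members. An edge is
    determined by two of its vertices, so that [i] members of a matching rule
    out at most [9 * i ^ 2] others, and a matching of [s + 9 * s ^ 2] edges
    contains [s] edges that induce a copy of [M_s]
    ([large_matching_isolated]). When there is no such copy, the vertices of a
    maximal matching form a transversal whose size is bounded by a constant
    [k] that depends on [s] only ([small_transversal]).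

    The complements of transversals are the stable sets, so a maximum stable
    set is the complement of a smallest transversal, and one is found by trying
    all tuples of at most [k] vertices ([covers_max_stable]). For the colouring
    problems, all ways to colour the vertices of a transversal of size at most
    [k] are tried. Once these colours are fixed, an edge constrains at most two
    of its remaining vertices, and what is left is an instance of 2-SAT: it is
    satisfiable if and only if no literal reaches its negation and back in the
    implication graph ([two_sat], [extendableP]).

    The programs are not written down. A function of a context is called
    computable if some program evaluates it into a register, without writing to
    memory, in a time polynomial in a bound stored in register 0
    ([computable]). These functions are closed under arithmetic, memory access,
    tests and loops that run [bound] times ([computable_iteri]), hence under
    bounded quantifiers and under search over tuples of fixed length. To keep
    memory constant, a set of numbers is stored in one register as a binary
    word ([word], [bit]); this is how reachability is computed
    ([computable_reach]). An answer is one such word, which a last loop copies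
    to memory ([poly_time_solvable_of_computable]). It then suffices to express the
    search by closed formulas in the numbers of the vertices, and to check that
    the encoding of the input gives access to the number of vertices and to the
    edges ([computable_order], [computable_edge_at]). *)

(** * Finite sets of numbers as binary words *)

Definition word (N : nat) (P : pred nat) : nat := \sum_(0 <= y < N) P y * 2 ^ y.

Lemma wordS N P : word N.+1 P = word N P + P N * 2 ^ N.
Proof. by rewrite /word big_nat_recr. Qed.

Lemma word_lt N P : word N P < 2 ^ N.
Proof.
elim: N => [|N IH]; first by rewrite /word big_geq.
by rewrite wordS expnS mul2n -addnn; case: (P N); lia.
Qed.

Lemma eq_word N (P Q : pred nat) :
  (forall y, y < N -> P y = Q y) -> word N P = word N Q.
Proof.
by move=> PQ; apply: eq_big_nat => y /andP[_ yN]; rewrite PQ.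
Qed.

(** Membership of [y] in the set coded by [c] is decided without division, by
    removing from [c] its powers of two from the highest one down to the one
    of exponent [y.+1]. *)
Definition bit (N c y : nat) : bool :=
  2 ^ minn y N <= iteri N (fun i acc =>
    if (y < N - i.+1) && (2 ^ (N - i.+1) <= acc)
    then acc - 2 ^ (N - i.+1) else acc) c.

Lemma bit_word N P y : y < N -> bit N (word N P) y = P y.
Proof.
move=> yN; rewrite /bit; set f := fun i acc => _.
have inv i : i <= N -> iteri i f (word N P) = word (maxn (N - i) y.+1) P.
  elim: i => [|i IH] iN; first by rewrite subn0 (maxn_idPl yN).
  rewrite iteriS IH ?(ltnW iN) // /f.
  have -> : N - i = (N - i.+1).+1 by lia.
  case: ltnP => [yz | zy] /=; last by congr word; lia.
  rewrite !(maxn_idPl _); try lia.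
  rewrite wordS; have := word_lt (N - i.+1) P.
  by case: (P _); case: ifP; rewrite ?mul1n ?mul0n; lia.
rewrite (inv N) // subnn max0n wordS (minn_idPl (ltnW yN)).
by have := word_lt y P; case: (P y); rewrite ?mul1n ?mul0n; lia.
Qed.

(** * Reachability in a relation on an initial segment *)

Definition step (N : nat) (e : rel nat) (S : pred nat) : pred nat :=
  fun y => S y || has (fun z => S z && e z y) (iota 0 N).

Definition reach (N : nat) (e : rel nat) (x y : nat) : bool :=
  (y < N) && iter N (step N e) (pred1 x) y.

(** [N] rounds suffice because a path without repetition has at most [N]
    points. *)
Lemma reachP N (e : rel nat) x y : x < N ->
  reflect (exists p, [/\ path e x p, last x p = y & all (gtn N) p])
          (reach N e x y).
Proof.
move=> xN; apply: (iffP andP) => [[yN] | [p []]].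
  move: {1}N => n; elim: n y yN => [|n IH] y yN /=.
    by move=> yx; exists [::]; rewrite (eqP yx).
  case/orP => [|/hasP[z]]; first exact: IH.
  rewrite mem_iota => /andP[_ zN] /andP[].
  case/(IH z zN) => p [ep lp pN] zy; exists (rcons p y).
  by rewrite rcons_path ep last_rcons all_rcons /= yN pN lp zy.
case/shortenP => {}p' ep up pp' <- pN.
have {pp' pN} pN : all (gtn N) p' by apply/allP => z /pp' /(allP pN).
have sz : size p' <= N.
  rewrite -(size_iota 0 N); apply: uniq_leq_size; first by case/andP: up.
  by move=> z /(allP pN); rewrite mem_iota.
split.
  case/lastP: p' pN {ep up sz} => [|q z] //.
  by rewrite last_rcons all_rcons => /andP[].
have mono n m : n <= m ->
    subpred (iter n (step N e) (pred1 x)) (iter m (step N e) (pred1 x)).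
  move=> nm z; rewrite -(subnK nm) iterD.
  by elim: (m - n) => //= k IH /IH; rewrite /step => ->.
apply: mono sz _ _.
elim/last_ind: p' ep pN {up} => [|q z IH]; first by rewrite /= eqxx.
rewrite rcons_path all_rcons size_rcons last_rcons => /andP[eq lqz] /andP[zN qN].
rewrite iterS /step; apply/orP; right; apply/hasP; exists (last x q).
  rewrite mem_iota /=; case/lastP: q qN {IH eq lqz} => [|q w] //.
  by rewrite last_rcons all_rcons => /andP[].
by rewrite IH.
Qed.

(** * Bounded search for tuples *)

Fixpoint max_tuple (N k : nat) (F : seq nat -> nat) : nat :=
  if k is k'.+1 then max_tuple N k' (fun s => \max_(0 <= x < N) F (x :: s))
  else F [::].

Lemma leq_max_tuple N k F s :
  size s = k -> all (gtn N) s -> F s <= max_tuple N k F.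
Proof.
elim: k s F => [|k IH] [|x s] F //= [sk] /andP[xN sN].
apply: leq_trans (IH s _ sk sN).
by apply: (leq_bigmax_seq (F := fun x => F (x :: s))) => //; rewrite mem_index_iota.
Qed.

Lemma max_tuple_attained N k F : max_tuple N k F != 0 ->
  exists s, [/\ size s = k, all (gtn N) s & F s = max_tuple N k F].
Proof.
elim: k F => [|k IH] F /=; first by exists [::].
move=> nz; have [s [sk sN es]] := IH _ nz.
rewrite -es in nz *.
have : exists2 x, x < N & F (x :: s) = \max_(0 <= x < N) F (x :: s).
  elim: (N) nz => [|n IHn]; first by rewrite big_geq.
  rewrite big_nat_recr //=; case: (leqP (\max_(0 <= i < n) F (i :: s)) (F (n :: s))) => [_ _|lt nz].
    by exists n.
  by have [|x xn <-] := IHn; [lia | exists x; rewrite // ltnS ltnW].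
case=> x xN ex; exists (x :: s); split=> //=; first by rewrite sk.
by rewrite xN.
Qed.

Definition exists_tuple (N k : nat) (P : seq nat -> bool) : bool :=
  0 < max_tuple N k P.

Lemma exists_tupleP N k (P : seq nat -> bool) :
  reflect (exists s, [/\ size s = k, all (gtn N) s & P s]) (exists_tuple N k P).
Proof.
apply: (iffP idP) => [|[s [sk sN Ps]]].
  rewrite /exists_tuple lt0n => nz; have [s [sk sN Ps]] := max_tuple_attained nz.
  by exists s; split=> //; case: (P s) Ps nz => // <-.
by apply: leq_trans (leq_max_tuple _ sk sN); rewrite Ps.
Qed.

(** * Polynomially bounded running times *)

Definition poly_bounded (f : nat -> nat) : Prop :=
  exists q : {poly nat}, forall x, f x <= (q.[x])%R.

Lemma poly_bounded_const k : poly_bounded (fun=> k).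
Proof. by exists (k%:P)%R => x; rewrite hornerC. Qed.

Lemma poly_bounded_id : poly_bounded id.
Proof. by exists 'X%R => x; rewrite hornerX. Qed.

Lemma poly_bounded_add f g :
  poly_bounded f -> poly_bounded g -> poly_bounded (fun x => f x + g x).
Proof.
by move=> [p fp] [q gq]; exists (p + q)%R => x; rewrite hornerD leq_add.
Qed.

Lemma poly_bounded_mul f g :
  poly_bounded f -> poly_bounded g -> poly_bounded (fun x => f x * g x).
Proof.
by move=> [p fp] [q gq]; exists (p * q)%R => x; rewrite hornerM leq_mul.
Qed.

Lemma poly_bounded_comp f (p : {poly nat}) :
  poly_bounded f -> poly_bounded (fun x => f (p.[x])%R).
Proof. by move=> [q fq]; exists (q \Po p)%R => x; rewrite horner_comp. Qed.

(** * Computable functions of a context *)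

(* The projection [mem] is shadowed by the one to collective predicates. *)
Local Notation ram := Defs.mem.

Ltac regs :=
  rewrite /= /update /=; repeat (case: eqP => ? /=); try lia; try by auto.

Section Machine.

Variables (A : Type) (cells : A -> nat -> nat) (bound : A -> nat).

(** A context describes what a program may rely on when it starts: a [point]
    gives an instance, its [root], whose word is in memory, and the values of
    finitely many variables, the [slots], which are held in registers. Bound
    variables are handled by extending the context, so that a formula with
    quantifiers is computable as soon as its body is, over the extended
    context. *)
Record ctx := Ctx {
  point :> Type;
  root : point -> A;
  slots : seq (point -> nat) }.

Definition extend (C : ctx) : ctx :=
  @Ctx (C * nat)%type (fun a => root a.1)
       (snd :: [seq (fun a => r a.1) | r <- slots C]).

(** The variables are in the registers listed in [nu], and the registers from
    [d] on are free. *)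
Definition loaded (C : ctx) (a : C) (nu : seq nat) (d : nat) (st : state) :=
  [/\ 0 < d, all (gtn d) nu,
      [seq reg st i | i <- nu] = [seq r a | r <- slots C],
      reg st 0 = bound (root a) & ram st =1 cells (root a)].

(** A program is parametrized by the registers [nu] of the variables and by the
    first free register [d], so that it can be used as a part of any other. *)
Definition computes (C : ctx) (p : seq nat -> nat -> program) (q : nat -> nat)
    (f : C -> nat) : Prop :=
  forall a nu d st, loaded a nu d st -> exists t st',
    [/\ exec (p nu d) st t st', t <= q (bound (root a)), reg st' d = f a,
        forall r, r < d -> reg st' r = reg st r & ram st' = ram st].

Definition computable (C : ctx) (f : C -> nat) : Prop :=
  exists p q, poly_bounded q /\ computes p q f.

Implicit Types C : ctx.

Lemma loaded_agree C (a : C) nu d d' st st' : loaded a nu d st -> d <= d' ->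
  (forall r, r < d -> reg st' r = reg st r) -> ram st' = ram st ->
  loaded a nu d' st'.
Proof.
move=> [d0 /allP nud enu e0 em] dd' er em'; split; first exact: leq_trans dd'.
- by apply/allP => i /nud /= id; apply: leq_trans id dd'.
- by rewrite -enu; apply/eq_in_map => i /nud /= /er.
- by rewrite er.
- by rewrite em'.
Qed.

Lemma loaded_extend C (a : C) nu d st i :
  loaded a nu d st -> i < d -> loaded (C := extend C) (a, reg st i) (i :: nu) d st.
Proof.
move=> [d0 nud enu e0 em] id; split=> //=; first by rewrite id.
by rewrite enu -map_comp.
Qed.

Lemma eq_computable C (f g : C -> nat) : f =1 g -> computable f -> computable g.
Proof.
move=> fg [p [q [pq fP]]]; exists p, q; split=> // a nu d st /fP.
by rewrite fg.
Qed.

(** The register of the variable that is not used is dropped from [nu]. *)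
Lemma computable_weaken C (f : C -> nat) :
  computable f -> computable (fun a : extend C => f a.1).
Proof.
move=> [p [q [pq fP]]]; exists (fun nu => p (behead nu)), q; split=> //.
move=> [a v] [|i nu] d st [] //= d0 /andP[_ nud] [_ enu] e0 em.
by apply: fP; split=> //; rewrite enu -map_comp.
Qed.

(** Register [d.+1], which is free, provides the null second operand that turns
    an addition into a copy. *)
Lemma computable_var C : computable (fun a : extend C => a.2).
Proof.
exists (fun nu d => Seq (Const d.+1 0) (Add d (head 0 nu) d.+1)), (fun=> 2).
split; first exact: poly_bounded_const.
move=> [a v] [|i nu] d st [] //= d0 /andP[id nud] [iv enu] e0 em.
do 2!eexists; split.
- by apply: exec_seq; constructor.
- by [].
- by regs.
- by move=> r rd; regs.
- by [].
Qed.

Lemma computable_const C k : computable (fun a : C => k).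
Proof.
exists (fun nu d => Const d k), (fun=> 1).
split; first exact: poly_bounded_const.
move=> a nu d st _; do 2!eexists; split; first by constructor.
- by [].
- by regs.
- by move=> r rd; regs.
- by [].
Qed.

Lemma computable_bound C : computable (fun a : C => bound (root a)).
Proof.
exists (fun nu d => Seq (Const d.+1 0) (Add d 0 d.+1)), (fun=> 2).
split; first exact: poly_bounded_const.
move=> a nu d st [d0 nud enu e0 em].
do 2!eexists; split.
- by apply: exec_seq; constructor.
- by [].
- by regs.
- by move=> r rd; regs.
- by [].
Qed.

Lemma computable_load C (f : C -> nat) :
  computable f -> computable (fun a => cells (root a) (f a)).
Proof.
move=> [p [q [pq fP]]].
exists (fun nu d => Seq (p nu d) (Read d d)), (fun x => q x + 1).
split; first by apply: poly_bounded_add => //; apply: poly_bounded_const.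
move=> a nu d st ld; have [t [st1 [ex tq ef er em]]] := fP _ _ _ _ ld.
do 2!eexists; split.
- by apply: exec_seq ex _; constructor.
- by rewrite leq_add2r.
- by regs; rewrite ef em; case: ld.
- by move=> r rd; regs.
- by rewrite /= em.
Qed.

Lemma computable_binop (op : nat -> nat -> nat) (instr : nat -> nat -> nat -> program) :
    (forall st i j k,
       exec (instr i j k) st 1 (set_reg st i (op (reg st j) (reg st k)))) ->
  forall C (f g : C -> nat),
  computable f -> computable g -> computable (fun a => op (f a) (g a)).
Proof.
move=> opP C f g [p [q [pq fP]]] [p' [q' [pq' gP]]].
exists (fun nu d => Seq (p nu d) (Seq (p' nu d.+1) (instr d d d.+1))).
exists (fun x => q x + (q' x + 1)).
split; first by do 2!apply: poly_bounded_add => //; apply: poly_bounded_const.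
move=> a nu d st ld; have [t [st1 [ex tq ef er em]]] := fP _ _ _ _ ld.
have [|t' [st2 [ex' tq' eg er' em']]] := gP a nu d.+1 st1.
  exact: loaded_agree ld _ er em.
do 2!eexists; split.
- by apply: exec_seq ex _; apply: exec_seq ex' _; apply: opP.
- by rewrite leq_add // leq_add2r.
- by rewrite /= /update eqxx eg er' // ef.
- move=> r rd; rewrite /= /update; case: eqP => [|_]; first lia.
  by rewrite er' ?er //; apply: ltnW.
- by rewrite /= em' em.
Qed.

Lemma computable_add C (f g : C -> nat) :
  computable f -> computable g -> computable (fun a => f a + g a).
Proof. by apply: computable_binop; constructor. Qed.

Lemma computable_sub C (f g : C -> nat) :
  computable f -> computable g -> computable (fun a => f a - g a).
Proof. by apply: computable_binop; constructor. Qed.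

Lemma computable_if C (b : C -> bool) (f g : C -> nat) :
  computable (fun a => b a) -> computable f -> computable g ->
  computable (fun a => if b a then f a else g a).
Proof.
move=> [p0 [q0 [pq0 bP]]] [p [q [pq fP]]] [p' [q' [pq' gP]]].
exists (fun nu d => Seq (p0 nu d) (If d (p nu d) (p' nu d))).
exists (fun x => q0 x + (q x + q' x + 1)).
split.
  do 2!apply: poly_bounded_add => //; first exact: poly_bounded_add.
  exact: poly_bounded_const.
move=> a nu d st ld; have [t [st1 [ex tq ef er em]]] := bP _ _ _ _ ld.
have ld1 := loaded_agree ld (leqnn d) er em.
case: (b a) ef => /= ef.
  have [t' [st2 [ex' tq' eg er' em']]] := fP _ _ _ _ ld1.
  exists (t + t'.+1), st2; split=> //; last by rewrite em'.
  - by apply: exec_seq ex _; apply: exec_if_true; rewrite // ef.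
  - by lia.
  - by move=> r rd; rewrite er' ?er.
have [t' [st2 [ex' tq' eg er' em']]] := gP _ _ _ _ ld1.
exists (t + t'.+1), st2; split=> //; last by rewrite em'.
- by apply: exec_seq ex _; apply: exec_if_false.
- by lia.
- by move=> r rd; rewrite er' ?er.
Qed.

(** Every loop runs [bound] times, so that its cost is [bound] times the cost
    of its body. Registers [d], [d.+1] and [d.+2] hold the accumulator, the
    index and the number of rounds still to be done. *)
Lemma computable_iteri C (z : C -> nat) (F : C -> nat -> nat -> nat) :
  computable z ->
  computable (fun a : extend (extend C) => F a.1.1 a.1.2 a.2) ->
  computable (fun a => iteri (bound (root a)) (F a) (z a)).
Proof.
move=> [p [q [pq zP]]] [p' [q' [pq' FP]]].
pose body nu d :=
  Seq (p' [:: d, d.+1 & nu] d.+3)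
  (Seq (Const d.+4 0) (Seq (Add d d.+3 d.+4)
  (Seq (Const d.+4 1) (Seq (Add d.+1 d.+1 d.+4) (Defs.Sub d.+2 d.+2 d.+4))))).
exists (fun nu d => Seq (p nu d)
  (Seq (Seq (Const d.+1 0) (Add d.+2 0 d.+1)) (While d.+2 (body nu d)))).
exists (fun x => q x + (x * (q' x + 6) + 3)).
split.
  apply: poly_bounded_add => //.
  apply: poly_bounded_add; last exact: poly_bounded_const.
  apply: poly_bounded_mul; first exact: poly_bounded_id.
  by apply: poly_bounded_add => //; apply: poly_bounded_const.
move=> a nu d st ld; have [t [st1 [ex tq ez er em]]] := zP _ _ _ _ ld.
have ld1 := loaded_agree ld (leqnn d) er em.
set N := bound (root a).
(* The loop is entered with [i] rounds done and [n] to be done. *)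
have loop n i st' : i + n = N -> reg st' d = iteri i (F a) (z a) ->
    reg st' d.+1 = i -> reg st' d.+2 = n ->
    (forall r, r < d -> reg st' r = reg st r) -> ram st' = ram st ->
  exists t st'', [/\ exec (While d.+2 (body nu d)) st' t st'',
    t <= n * (q' N + 6) + 1, reg st'' d = iteri N (F a) (z a),
    forall r, r < d -> reg st'' r = reg st r & ram st'' = ram st].
  elim: n i st' => [|n IH] i st' iN eacc ei en er' em'.
    exists 1, st'; split=> //; first by apply: exec_while_stop.
    by rewrite -iN addn0.
  have ld2 : loaded (C := extend (extend C))
      (a, reg st' d.+1, reg st' d) [:: d, d.+1 & nu] d.+3 st'.
    apply: (@loaded_extend (extend C) (a, _) (d.+1 :: nu)); last by lia.
    apply: (@loaded_extend C a nu); last by lia.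
    by apply: loaded_agree ld _ er' em'; lia.
  have [t2 [st2 [ex2 tq2 ef2 er2 em2]]] := FP _ _ _ _ ld2.
  rewrite /= ei eacc in ef2; rewrite /= in tq2.
  have [t3 [st3 [ex3 et3 eacc3 [ei3 en3] [er3 em3]]]] : exists t3 st3,
      [/\ exec (Seq (Const d.+4 0) (Seq (Add d d.+3 d.+4) (Seq (Const d.+4 1)
             (Seq (Add d.+1 d.+1 d.+4) (Defs.Sub d.+2 d.+2 d.+4))))) st2 t3 st3,
          t3 = 5, reg st3 d = iteri i.+1 (F a) (z a),
          reg st3 d.+1 = i.+1 /\ reg st3 d.+2 = n
        & (forall r, r < d -> reg st3 r = reg st r) /\ ram st3 = ram st].
    do 2!eexists; split.
    - by do 4!(apply: exec_seq; first by constructor); constructor.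
    - by [].
    - by regs.
    - by split; regs; rewrite er2 ?ei ?en //; lia.
    - split; last by rewrite /= em2.
      by move=> r rd; regs; rewrite er2 ?er' //; lia.
  have [|t4 [st4 [ex4 tq4 ef4 er4 em4]]] := IH i.+1 st3 _ eacc3 ei3 en3 er3 em3.
    by rewrite addSnnS.
  exists (t2 + t3 + t4).+1, st4; split=> //; last by rewrite /N in tq4 *; lia.
  apply: exec_while_loop ex4; first by rewrite en.
  exact: exec_seq ex2 ex3.
have [st2 [ex2 eacc2 ei2 en2 [er2 em2]]] : exists st2,
    [/\ exec (Seq (Const d.+1 0) (Add d.+2 0 d.+1)) st1 2 st2,
        reg st2 d = z a, reg st2 d.+1 = 0, reg st2 d.+2 = N
      & (forall r, r < d -> reg st2 r = reg st r) /\ ram st2 = ram st].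
  case: ld1 => d0 _ _ e0 _; eexists; split.
  - by apply: (exec_seq (t := 1) (t' := 1)); constructor.
  - by regs.
  - by regs.
  - by regs.
  - by split=> // r rd; regs; rewrite er.
have [t3 [st3 [ex3 tq3 ef3 er3 em3]]] :=
  loop N 0 st2 (add0n N) eacc2 ei2 en2 er2 em2.
exists (t + (2 + t3)), st3; split=> //; last by rewrite /N in tq3 *; lia.
exact: exec_seq ex (exec_seq ex2 ex3).
Qed.

Lemma computable_succ C (f : C -> nat) :
  computable f -> computable (fun a => (f a).+1).
Proof.
move=> cf; apply: (@eq_computable C (fun a => f a + 1)).
  by move=> a; rewrite addn1.
by apply: computable_add => //; apply: computable_const.
Qed.

Lemma computable_leq C (f g : C -> nat) :
  computable f -> computable g -> computable (fun a => f a <= g a).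
Proof.
move=> cf cg; apply: (@eq_computable C (fun a => 1 - (f a - g a))).
  by move=> a; rewrite -subn_eq0; case: (f a - g a).
by apply: computable_sub; [apply: computable_const | apply: computable_sub].
Qed.

Lemma computable_negb C (b : C -> bool) :
  computable (fun a => b a) -> computable (fun a => ~~ b a).
Proof.
move=> cb; apply: (@eq_computable C (fun a => 1 - b a)).
  by move=> a; case: (b a).
by apply: computable_sub => //; apply: computable_const.
Qed.

Lemma computable_andb C (b c : C -> bool) :
  computable (fun a => b a) -> computable (fun a => c a) ->
  computable (fun a => b a && c a).
Proof.
move=> cb cc; apply: (@eq_computable C (fun a => if b a then c a : nat else 0)).
  by move=> a; case: (b a).
by apply: computable_if => //; apply: computable_const.
Qed.

Lemma computable_orb C (b c : C -> bool) :
  computable (fun a => b a) -> computable (fun a => c a) ->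
  computable (fun a => b a || c a).
Proof.
move=> cb cc; apply: (@eq_computable C (fun a => if b a then 1 else c a : nat)).
  by move=> a; case: (b a).
by apply: computable_if => //; apply: computable_const.
Qed.

Lemma computable_eqn C (f g : C -> nat) :
  computable f -> computable g -> computable (fun a => f a == g a).
Proof.
move=> cf cg; apply: (@eq_computable C (fun a => (f a <= g a) && (g a <= f a))).
  by move=> a; rewrite eqn_leq.
by apply: computable_andb; apply: computable_leq.
Qed.

Lemma computable_sum C (F : C -> nat -> nat) :
  computable (fun a : extend C => F a.1 a.2) ->
  computable (fun a => \sum_(0 <= i < bound (root a)) F a i).
Proof.
move=> cF.
apply: (@eq_computable C
  (fun a => iteri (bound (root a)) (fun i acc => acc + F a i) 0)).
  move=> a; elim: (bound _) => [|n IH]; first by rewrite big_geq.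
  by rewrite big_nat_recr //= IH.
apply: (computable_iteri (F := fun a i acc => acc + F a i)).
  exact: computable_const.
by apply: computable_add; [apply: computable_var | apply: (computable_weaken cF)].
Qed.

Lemma computable_max C (F : C -> nat -> nat) :
  computable (fun a : extend C => F a.1 a.2) ->
  computable (fun a => \max_(0 <= i < bound (root a)) F a i).
Proof.
move=> cF; pose G a i acc := if acc < F a i then F a i else acc.
apply: (@eq_computable C (fun a => iteri (bound (root a)) (G a) 0)).
  move=> a; elim: (bound _) => [|n IH]; first by rewrite big_geq.
  by rewrite big_nat_recr //= IH /maxn.
apply: (computable_iteri (F := G)); first exact: computable_const.
have cF' := computable_weaken cF.
apply: computable_if => //; last exact: computable_var.
by apply: computable_leq => //; apply: computable_succ; apply: computable_var.
Qed.

Lemma computable_has C (P : C -> nat -> bool) :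
  computable (fun a : extend C => P a.1 a.2) ->
  computable (fun a => has (P a) (iota 0 (bound (root a)))).
Proof.
move=> cP.
apply: (@eq_computable C
  (fun a => 0 < \sum_(0 <= i < bound (root a)) P a i)).
  move=> a; rewrite has_count -sum1_count [in RHS]big_mkcond /index_iota subn0.
  by congr (0 < _); apply: eq_bigr => i _; case: (P a i).
apply: computable_leq; first exact: computable_const.
exact: (computable_sum (F := fun a i => P a i)).
Qed.

Lemma computable_all C (P : C -> nat -> bool) :
  computable (fun a : extend C => P a.1 a.2) ->
  computable (fun a => all (P a) (iota 0 (bound (root a)))).
Proof.
move=> cP.
apply: (@eq_computable C
  (fun a => ~~ has (fun i => ~~ P a i) (iota 0 (bound (root a))))).
  by move=> a; rewrite has_predC negbK.
apply: computable_negb; apply: (computable_has (P := fun a i => ~~ P a i)).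
exact: computable_negb.
Qed.

(** There is no multiplication instruction: the product is obtained by adding
    [g a] once for each index below [f a], which requires [f a] to be within
    the range of a loop. *)
Lemma computable_mul C (f g : C -> nat) :
  (forall a, f a <= bound (root a)) ->
  computable f -> computable g -> computable (fun a => f a * g a).
Proof.
move=> f_le cf cg.
apply: (@eq_computable C
  (fun a => \sum_(0 <= i < bound (root a)) if i < f a then g a else 0)).
  move=> a; rewrite -big_mkcond /= -(big_nat_widen _ _ _ xpredT) //.
  by rewrite big_const_nat subn0 iter_addn_0 mulnC.
apply: (computable_sum (F := fun a i => if i < f a then g a else 0)).
apply: computable_if.
- apply: computable_leq; last exact: computable_weaken.
  by apply: computable_succ; apply: computable_var.
- exact: computable_weaken.
- exact: computable_const.
Qed.

(** Doubling at each round gives the power of two of any exponent that the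
    loop can reach. *)
Lemma computable_pow2 C (f : C -> nat) :
  computable f -> computable (fun a => 2 ^ minn (f a) (bound (root a))).
Proof.
move=> cf; pose G a i acc := if i < f a then acc + acc else acc.
apply: (@eq_computable C (fun a => iteri (bound (root a)) (G a) 1)).
  move=> a; elim: (bound _) => [|n IH] /=; first by rewrite minn0.
  rewrite IH /G; case: ltnP => fn; last by rewrite !(minn_idPl _) //; lia.
  have -> : minn (f a) n.+1 = n.+1 by lia.
  by rewrite addnn -mul2n -expnS.
apply: (computable_iteri (F := G)); first exact: computable_const.
have cacc := computable_var (extend C).
apply: computable_if => //; last exact: computable_add.
apply: computable_leq; last exact: (computable_weaken (computable_weaken cf)).
exact: computable_succ (computable_weaken (computable_var C)).
Qed.

Lemma computable_bit C (f g : C -> nat) : computable f -> computable g ->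
  computable (fun a => bit (bound (root a)) (f a) (g a)).
Proof.
move=> cf cg; apply: computable_leq; first exact: computable_pow2.
pose G a i acc :=
  if (g a < bound (root a) - i.+1) &&
     (2 ^ minn (bound (root a) - i.+1) (bound (root a)) <= acc)
  then acc - 2 ^ minn (bound (root a) - i.+1) (bound (root a)) else acc.
apply: (@eq_computable C (fun a => iteri (bound (root a)) (G a) (f a))).
  by move=> a; apply: eq_iteri => i acc; rewrite /G (minn_idPl (leq_subr _ _)).
apply: (computable_iteri (F := G)) => //.
have cacc := computable_var (extend C).
have cz : computable (fun a : extend (extend C) => bound (root a.1.1) - a.1.2.+1).
  apply: computable_sub; first exact: computable_bound.
  exact: computable_succ (computable_weaken (computable_var C)).
have cp := computable_pow2 cz.
apply: computable_if => //; last exact: computable_sub.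
apply: computable_andb; apply: computable_leq => //.
exact: computable_succ (computable_weaken (computable_weaken cg)).
Qed.

Lemma computable_word C (P : C -> nat -> bool) :
  computable (fun a : extend C => P a.1 a.2) ->
  computable (fun a => word (bound (root a)) (P a)).
Proof.
move=> cP; pose F a y := if P a y then 2 ^ minn y (bound (root a)) else 0.
apply: (@eq_computable C (fun a => \sum_(0 <= y < bound (root a)) F a y)).
  move=> a; apply: eq_big_nat => y /andP[_ yN].
  by rewrite /F (minn_idPl (ltnW yN)); case: (P a y); rewrite ?mul1n.
apply: (computable_sum (F := F)); apply: computable_if => //.
  exact: (computable_pow2 (computable_var C)).
exact: computable_const.
Qed.

(** The accumulator of the loop is the word of the set of points reached. *)
Lemma computable_reach C (e : C -> rel nat) (f g : C -> nat) :
  computable (fun a : extend (extend (extend (extend C))) =>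
                e a.1.1.1.1 a.2 a.1.2) ->
  computable f -> computable g ->
  computable (fun a => reach (bound (root a)) (e a) (f a) (g a)).
Proof.
move=> ce cf cg; pose N (a : C) := bound (root a).
pose G a (i : nat) acc := word (N a) (step (N a) (e a) (bit (N a) acc)).
pose c a := iteri (N a) (G a) (word (N a) (pred1 (f a))).
apply: (@eq_computable C (fun a => (g a < N a) && bit (N a) (c a) (g a))).
  move=> a; rewrite /reach -/(N a); case: ltnP => //= gN; congr nat_of_bool.
  suff -> : c a = word (N a) (iter (N a) (step (N a) (e a)) (pred1 (f a))).
    exact: bit_word.
  rewrite /c; move: {1 4}(N a) => n; elim: n => //= n ->.
  apply: eq_word => y yN; rewrite /step bit_word //; congr (_ || _).
  by apply: eq_in_has => z; rewrite mem_iota => /andP[_ zN]; rewrite bit_word.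
have cN := computable_bound C.
apply: computable_andb; first exact: computable_leq (computable_succ cg) cN.
apply: computable_bit => //; apply: (computable_iteri (F := G)).
  apply: (computable_word (P := fun a => pred1 (f a))).
  apply: (@computable_eqn (extend C) snd (fun a => f a.1)).
    exact: computable_var.
  exact: computable_weaken.
apply: (computable_word (C := extend (extend C))
          (P := fun a => step (N a.1.1) (e a.1.1) (bit (N a.1.1) a.2))).
have cbit : computable (fun a : extend (extend (extend C)) =>
    bit (N a.1.1.1) a.1.2 a.2).
  apply: (computable_bit (C := extend (extend (extend C)))).
    exact: computable_weaken (computable_var _).
  exact: computable_var.
apply: computable_orb => //.
apply: (computable_has (C := extend (extend (extend C)))
  (P := fun a z => bit (N a.1.1.1) a.1.2 z && e a.1.1.1 z a.2)).
apply: computable_andb => //.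
apply: (computable_bit (C := extend (extend (extend (extend C))))).
  exact: (computable_weaken (computable_weaken (computable_var _))).
exact: computable_var.
Qed.

(** * Search over tuples *)

Fixpoint extend_by (k : nat) (C : ctx) : ctx :=
  if k is k'.+1 then extend (extend_by k' C) else C.

(** A point of the context extended [k] times is a point of the original context
    together with a [k]-tuple. *)
Fixpoint base C k : extend_by k C -> C :=
  if k is k'.+1 then fun a => base a.1 else id.

Fixpoint tuple_of C k : extend_by k C -> seq nat :=
  if k is k'.+1 then fun a => a.2 :: tuple_of a.1 else fun=> [::].

Lemma root_base C k (a : extend_by k C) : root (base a) = root a.
Proof. by elim: k a => //= k IH a; apply: IH. Qed.

Lemma computable_max_tuple C k (F : C -> seq nat -> nat) :
  computable (fun a : extend_by k C => F (base a) (tuple_of a)) ->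
  computable (fun a => max_tuple (bound (root a)) k (F a)).
Proof.
elim: k F => [|k IH] F //= cF.
apply: (IH (fun a s => \max_(0 <= x < bound (root a)) F a (x :: s))).
pose G (a : extend_by k C) x := F (base a) (x :: tuple_of a).
apply: (@eq_computable (extend_by k C)
          (fun a => \max_(0 <= x < bound (root a)) G a x)).
  by move=> a; rewrite root_base.
exact: (computable_max (F := G)).
Qed.

Lemma computable_exists_tuple C k (P : C -> seq nat -> bool) :
  computable (fun a : extend_by k C => P (base a) (tuple_of a)) ->
  computable (fun a => exists_tuple (bound (root a)) k (P a)).
Proof.
move=> cP; apply: computable_leq; first exact: computable_const.
exact: (computable_max_tuple (F := fun a s => P a s)).
Qed.

(** A tuple of fixed length whose entries are computable; the sequence itself is
    never stored. *)
Inductive computable_seq C : (C -> seq nat) -> Prop :=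
| ComputableNil : computable_seq (fun=> [::])
| ComputableCons f s : computable f -> computable_seq s ->
    computable_seq (fun a => f a :: s a).

Lemma computable_seq_weaken C (s : C -> seq nat) :
  computable_seq s -> computable_seq (fun a : extend C => s a.1).
Proof.
elim=> [|f {}s cf _ IH]; first exact: ComputableNil.
exact: (ComputableCons (computable_weaken cf) IH).
Qed.

Lemma computable_seq_base C k (s : C -> seq nat) :
  computable_seq s -> computable_seq (fun a : extend_by k C => s (base a)).
Proof. by move=> cs; elim: k => //= k; apply: computable_seq_weaken. Qed.

Lemma computable_tuple_of C k : computable_seq (@tuple_of C k).
Proof.
elim: k => [|k IH]; first exact: ComputableNil.
exact: (ComputableCons (computable_var _) (computable_seq_weaken IH)).
Qed.

Lemma computable_mem C (f : C -> nat) (s : C -> seq nat) :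
  computable f -> computable_seq s -> computable (fun a => f a \in s a).
Proof.
move=> cf; elim=> [|g {}s cg _ IH]; first exact: (computable_const C 0).
by apply: computable_orb => //; apply: computable_eqn.
Qed.

End Machine.

(** * From computable functions to polynomial time *)

Section PolyTime.

Variables (P : problem) (valid : instance P -> Prop).

Definition valid_instance := {x : instance P | valid x}.

Definition input_cells (x : valid_instance) (i : nat) : nat :=
  nth false (encode (sval x)) i.

(** The factor two lets loops range over the literals, two for each vertex,
    even if there are no edges. *)
Definition input_bound (x : valid_instance) : nat := (size (encode (sval x))).*2.+2.

Definition input_ctx : ctx valid_instance := @Ctx _ valid_instance id [::].

Definition input_computable := @computable _ input_cells input_bound input_ctx.

(** The answer is computed into register 1 and its length into register 2 before
    anything is written, because writing the answer from address 0 on destroys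
    the input. Membership in a word does not read memory, so it can be
    evaluated while the answer is being written: it is computable in a context
    whose memory is arbitrary. *)
Lemma poly_time_solvable_of_computable (code len : valid_instance -> nat)
    (Q : valid_instance -> pred nat) :
  input_computable code -> input_computable len ->
  (forall x, code x = word (input_bound x) (Q x)) ->
  (forall x, len x <= input_bound x) ->
  (forall x, answer (sval x) (mkseq (Q x) (len x))) ->
  poly_time_solvable valid.
Proof.
move=> [pc [qc [pqc codeP]]] [pl [ql [pql lenP]]] code_word len_le ansP.
pose ctx0 := @Ctx _ ((nat -> nat) * nat)%type id [::].
have [pb [qb [pqb bitP]]] : @computable _ fst snd (extend (extend ctx0))
    (fun a => bit a.1.1.2 a.1.2 a.2).
  apply: (@computable_bit _ fst snd (extend (extend ctx0))).
    exact: computable_weaken (computable_var _ _ _).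
  exact: computable_var.
pose body := Seq (pb [:: 3; 1] 5) (Seq (Write 3 5)
  (Seq (Const 5 1) (Seq (Add 3 3 5) (Defs.Sub 4 4 5)))).
pose prelude := Seq (Add 0 0 0) (Seq (Const 1 2) (Add 0 0 1)).
pose setup := Seq (Const 3 0) (Add 4 0 3).
pose finish := Seq (Const 3 0) (Add 0 2 3).
pose prog := Seq prelude (Seq (pc [::] 1) (Seq (pl [::] 2)
  (Seq setup (Seq (While 4 body) finish)))).
pose cost x := qc x + (ql x + (x * (qb x + 5) + 8)).
have [q costP] : poly_bounded (fun n => cost (('X + 'X + 2%:P)%R : {poly nat}).[n]%R).
  apply: poly_bounded_comp; do 2!apply: poly_bounded_add => //.
  apply: poly_bounded_add; last exact: poly_bounded_const.
  apply: poly_bounded_mul; first exact: poly_bounded_id.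
  by apply: poly_bounded_add => //; apply: poly_bounded_const.
exists prog, q => x vx; pose a : valid_instance := exist _ x vx.
set w := encode x; set N := input_bound a.
have NE2 : size w + size w + 2 = N by rewrite addnn addn2.
have NE : (('X + 'X + 2%:P)%R : {poly nat}).[size w]%R = N.
  by rewrite !hornerD !hornerX hornerC -NE2.
suff [t [st [ex tq out]]] : exists t st,
    [/\ exec prog (init w) t st, t <= cost N & output st = mkseq (Q a) (len a)].
  exists t, st; split=> //; first by apply: leq_trans tq _; rewrite -NE; apply: costP.
  by rewrite out; apply: (ansP a).
have [st1 [ex1 e0 em1]] : exists st1, [/\ exec prelude (init w) 3 st1,
    reg st1 0 = N & Defs.mem st1 = Defs.mem (init w)].
  eexists; split.
  - by apply: (exec_seq (t := 1) (t' := 2)); [|apply: (exec_seq (t := 1) (t' := 1))]; constructor.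
  - by rewrite -NE2.
  - by [].
have [|t2 [st2 [ex2 tq2 ecode er2 em2]]] := codeP a [::] 1 st1.
  by split=> //; rewrite em1.
have [|t3 [st3 [ex3 tq3 elen er3 em3]]] := lenP a [::] 2 st2.
  by split=> //; rewrite ?er2 // em2 em1.
rewrite /= -/N in tq2 tq3.
have [st4 [ex4 ev [en eN] [ec el]]] : exists st4, [/\ exec setup st3 2 st4,
    reg st4 3 = 0, reg st4 4 = N /\ reg st4 0 = N
    & reg st4 1 = code a /\ reg st4 2 = len a].
  have e30 : reg st3 0 = N by rewrite er3 // er2.
  eexists; split.
  - by apply: (exec_seq (t := 1) (t' := 1)); constructor.
  - by regs.
  - by split; regs.
  - by split; regs; rewrite er3.
(* Registers 3 and 4 hold the next address and the number of rounds left. *)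
have loop n v st : v + n = N -> reg st 0 = N -> reg st 1 = code a ->
    reg st 2 = len a -> reg st 3 = v -> reg st 4 = n ->
    (forall i, i < v -> Defs.mem st i = Q a i) ->
  exists t st', [/\ exec (While 4 body) st t st', t <= n * (qb N + 5) + 1,
    reg st' 2 = len a & forall i, i < N -> Defs.mem st' i = Q a i].
  elim: n v st => [|n IH] v st vN e0' e1 e2 e3 e4 em.
    exists 1, st; split=> //; first exact: exec_while_stop.
    by move=> i iN; apply: em; lia.
  pose b : extend (extend ctx0) := ((Defs.mem st, N), code a, v).
  have [|t5 [st5 [ex5 tq5 eb er5 em5]]] := bitP b [:: 3; 1] 5 st.
    by split=> //=; rewrite ?e1 ?e3.
  rewrite /= code_word bit_word in eb tq5; last by rewrite -/N; lia.
  have [st6 [ex6 [e0'' e1'' e2''] [e3'' e4''] em6]] : exists st6,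
     [/\ exec (Seq (Write 3 5) (Seq (Const 5 1) (Seq (Add 3 3 5) (Defs.Sub 4 4 5))))
           st5 4 st6, [/\ reg st6 0 = N, reg st6 1 = code a & reg st6 2 = len a],
        reg st6 3 = v.+1 /\ reg st6 4 = n
      & forall i, i < v.+1 -> Defs.mem st6 i = Q a i].
    eexists; split.
    - apply: (exec_seq (t := 1) (t' := 3)); first by constructor.
      apply: (exec_seq (t := 1) (t' := 2)); first by constructor.
      by apply: (exec_seq (t := 1) (t' := 1)); constructor.
    - by split; regs; rewrite er5.
    - by split; regs; rewrite er5 // ?e3 ?e4; lia.
    - move=> i iv; rewrite /= /update er5 // e3 eb em5.
      by case: eqP => [-> // | ne]; apply: em; lia.
  have [|t7 [st7 [ex7 tq7 e27 em7]]] := IH v.+1 st6 _ e0'' e1'' e2'' e3'' e4'' em6.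
    by lia.
  exists (t5 + 4 + t7).+1, st7; split=> //; last by lia.
  apply: exec_while_loop ex7; first by rewrite e4.
  exact: exec_seq ex5 ex6.
have [//|t5 [st5 [ex5 tq5 el5 em5]]] := loop N 0 st4 (add0n N) eN ec el ev en.
exists (3 + (t2 + (t3 + (2 + (t5 + 2))))), (set_reg (set_reg st5 3 0) 0 (len a)).
split.
- apply: exec_seq ex1 _; apply: exec_seq ex2 _; apply: exec_seq ex3 _.
  apply: exec_seq ex4 _; apply: exec_seq ex5 _.
  apply: (exec_seq (t := 1) (t' := 1)); first by constructor.
  suff -> : len a = reg (set_reg st5 3 0) 2 + reg (set_reg st5 3 0) 3.
    by constructor.
  by rewrite /= /update /= el5 addn0.
- by rewrite /cost; lia.
- rewrite /output /=; apply/eq_in_map => i; rewrite mem_iota => /andP[_ iN].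
  rewrite /= em5; first by case: (Q a i).
  by apply: leq_trans iN _; rewrite /update /=; apply: len_le.
Qed.

End PolyTime.

(** * Matchings and transversals *)

Definition transversal_bound (s : nat) : nat := 3 * (s + 9 * s ^ 2).

Section Transversal.

Variables (s : nat) (G : hypergraph).
Hypotheses (G3 : three_uniform G) (Glin : linear_hg G).

Definition transversal (T : {set G}) : Prop :=
  forall e, e \in edges G -> ~~ [disjoint e & T].

Definition isolated (I : {set {set G}}) : Prop :=
  forall f, f \in edges G -> f \subset cover I -> f \in I.

Lemma card_cover_edges (I : {set {set G}}) :
  I \subset edges G -> #|cover I| <= 3 * #|I|.
Proof.
move=> /subsetP IE; apply: leq_trans (leq_card_cover I) _.
by rewrite mulnC -sum_nat_const leq_sum // => e /IE /G3 ->.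
Qed.

(** Numbering the edges of the matching, and the vertices of each of them, gives
    the isomorphism; being isolated means that there are no further edges. *)
Lemma isolated_matching_isomorphic (I : {set {set G}}) :
  I \subset edges G -> trivIset I -> #|I| = s -> isolated I ->
  isomorphic (induced (cover I)) (matching s).
Proof.
move=> /subsetP IE triv sI isoI.
pose e_ (i : 'I_s) : {set G} := enum_val (cast_ord (esym sI) i).
have e_I i : e_ i \in I by apply: enum_valP.
have e_inj : injective e_ by move=> i j /enum_val_inj /cast_ord_inj.
have card_e i : 3 = #|e_ i| by rewrite (G3 (IE _ (e_I i))).
pose v (p : 'I_s * 'I_3) : G := enum_val (cast_ord (card_e p.1) p.2).
have v_e p : v p \in e_ p.1 by apply: enum_valP.
have v_cover p : v p \in cover I.
  by apply/bigcupP; exists (e_ p.1).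
pose g p : induced (cover I) := Sub (v p) (v_cover p).
have g_inj : injective g.
  move=> [i j] [i' j'] /(congr1 val) /= vE.
  have {}i'E : i = i'.
    apply: e_inj; apply/eqP/negPn/negP => ne.
    have /disjointFr := trivIsetP triv _ _ (e_I i) (e_I i') ne.
    by move=> /(_ _ (v_e (i, j))); rewrite vE (v_e (i', j')).
  by move: j' vE; rewrite -i'E => j' /enum_val_inj /cast_ord_inj /= ->.
have [|f gK fK] := inj_card_bij g_inj.
  rewrite card_sig card_prod !card_ord mulnC -sI.
  by rewrite card_cover_edges //; apply/subsetP.
pose line (i : 'I_s) : {set 'I_s * 'I_3} := [set (i, j) | j : 'I_3].
have val_line i : [set val x | x in g @: line i] = e_ i.
  apply/eqP; rewrite eqEcard; apply/andP; split.
    apply/subsetP => _ /imsetP[_ /imsetP[_ /imsetP[j _ ->] ->] ->].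
    exact: (v_e (i, j)).
  rewrite -card_e card_imset; last exact: val_inj.
  rewrite card_imset // card_imset ?card_ord //.
  by move=> j j' [].
exists f; first by exists g.
move=> e; rewrite inE; apply/idP/imsetP => [eE | [i _ ei]].
  have /isoI/(_ _) eI := eE.
  have {eI} : [set val x | x in e] \in I.
    apply: eI; apply/subsetP => _ /imsetP[x _ ->]; exact: valP.
  move=> /[dup] eI /(enum_rankK_in eI).
  set r := enum_rank_in _ _ => er.
  exists (cast_ord sI r) => //.
  have eiE : [set val x | x in e] = e_ (cast_ord sI r).
    by rewrite /e_ cast_ordK er.
  have -> : e = g @: line (cast_ord sI r).
    by apply: (imset_inj val_inj); rewrite val_line.
  by rewrite -imset_comp (eq_imset _ gK) imset_id.
have -> : e = g @: line i.
  by rewrite /line -ei -imset_comp (eq_imset _ fK) imset_id.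
by rewrite val_line IE.
Qed.

(** The set [I] is built greedily. An edge [e] of the matching cannot be added
    to [I] only if some other edge [f] meets [e] and lies in the union of [e]
    and of the edges of [I]. By linearity [f] has at most one vertex in [e],
    hence two vertices in the union of [I]. These two vertices determine [f],
    and the third vertex of [f] determines [e]: at most [(3 * i) ^ 2] edges are
    ruled out when [I] has [i] elements. *)
Lemma large_matching_isolated (M : {set {set G}}) :
  M \subset edges G -> trivIset M -> s + 9 * s ^ 2 <= #|M| ->
  exists I : {set {set G}}, [/\ I \subset M, #|I| = s & isolated I].
Proof.
move=> /subsetP ME triv Mbig.
suff greedy i : i <= s -> exists I : {set {set G}}, [/\ I \subset M, #|I| = i & isolated I].
  exact: (greedy s).
elim: i => [|i IH] ilt.
  exists set0; split; rewrite ?sub0set ?cards0 // => f fE.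
  rewrite /cover big_set0 subset0 => /eqP f0.
  by move: fE; rewrite f0 (negPf (@edges_neq0 G)).
have [I [IM cI isoI]] := IH (ltnW ilt).
set W := cover I.
have cW : #|W| <= 3 * i.
  by rewrite -cI card_cover_edges //; apply/subsetP => e /(subsetP IM) /ME.
have disjW e : e \in M :\: I -> [disjoint e & W].
  rewrite inE => /andP[eI eM]; apply: bigcup_disjoint => f fI.
  apply: (trivIsetP triv) => //; first exact: (subsetP IM).
  by apply: contraNneq eI => ->.
(* [g] sends a pair of vertices of [W] to the edge that it rules out. *)
pose via (p : G * G) (e : {set G}) := [exists f in edges G,
  [&& p.1 \in f, p.2 \in f, p.1 != p.2 & f :&: e != set0]].
pose g p := odflt set0 [pick e in M :\: I | via p e].
case: (boolP [exists e in M :\: I,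
    [forall f in edges G, (f \subset cover (e |: I)) ==> (f \in e |: I)]]).
  case/exists_inP => e; rewrite inE => /andP[eI eM] /forall_inP good.
  exists (e |: I); split; last by move=> f fE; apply/implyP/good.
    by rewrite subUset sub1set eM.
  by rewrite cardsU1 eI cI.
rewrite negb_exists_in => /forall_inP bad.
have sub : M :\: I \subset g @: setX W W.
  apply/subsetP => e eMI; have := bad e eMI; rewrite negb_forall_in.
  case/exists_inP => f fE; rewrite negb_imply /cover big_setU1 /=; last by case/setDP: eMI.
  rewrite -/(cover I) -/W in_setU1 negb_or => /and3P[fsub fe fI].
  have eE : e \in edges G by apply: ME; case/setDP: eMI.
  have card_fe : #|f :&: e| <= 1 by apply: Glin.
  have : 1 < #|f :\: e| by have := cardsID e f; rewrite (G3 fE); lia.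
  case/card_gt1P => x [y [/setDP[xf xe] /setDP[yf ye] xy]].
  have inW z : z \in f -> z \notin e -> z \in W.
    by move=> /(subsetP fsub); rewrite inE => /orP[->|].
  apply/imsetP; exists (x, y); first by rewrite inE /= !inW.
  rewrite /g; case: pickP => [e' /andP[e'MI] | /(_ e)]; last first.
    rewrite eMI /= => /exists_inP[]; exists f => //=; rewrite xf yf xy /=.
    apply: contra fI => /eqP fe0; apply: isoI => //; apply/subsetP => z zf.
    by apply: inW => //; apply/negP => ze; have := in_set0 z; rewrite -fe0 inE zf ze.
  case/exists_inP => f' f'E /and4P[/= xf' yf' _ fe'].
  have ff' : f' = f.
    apply/eqP/negPn/negP => /(Glin f'E fE); apply/negP; rewrite -ltnNge.
    by apply/card_gt1P; exists x, y; rewrite !inE xf xf' yf yf'.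
  rewrite {f' f'E xf' yf'}ff' in fe'.
  have fe0 : f :&: e != set0.
    apply: contra fI => /eqP fe0; apply: isoI => //; apply/subsetP => z zf.
    by apply: inW => //; apply/negP => ze; have := in_set0 z; rewrite -fe0 inE zf ze.
  case/set0Pn: fe0 => z /setIP[zf ze]; case/set0Pn: fe' => z' /setIP[z'f z'e'].
  have notW w h : h \in M :\: I -> w \in h -> w \in W -> False.
    by move=> /disjW /disjointFr hW /hW ->.
  (* Otherwise [f] would have the four vertices [x], [y], [z] and [z']. *)
  have zE : z = z'.
    apply/eqP/negPn/negP => zz'.
    have : #|[set x; y; z; z']| <= #|f|.
      apply: subset_leq_card; apply/subsetP => w.
      by rewrite !inE -!orbA => /or4P[] /eqP->.
    have xW := inW x xf xe; have yW := inW y yf ye.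
    have ne h w w' : h \in M :\: I -> w \in h -> w' \in W -> w' != w.
      by move=> hM wh; apply: contraTneq => ->; apply/negP; apply: (notW w h).
    by rewrite (G3 fE) -!setUA !cardsU1 cards1 !inE !negb_or xy zz'
      (ne e z x) // (ne e z y) // (ne e' z' x) // (ne e' z' y).
  apply/eqP/negPn/negP => ee'.
  have [eM e'M] : e \in M /\ e' \in M by move: eMI e'MI => /setDP[? _] /setDP[].
  have /disjointFr := trivIsetP triv _ _ eM e'M ee'.
  by move=> /(_ _ ze); rewrite zE z'e'.
have := leq_trans (subset_leq_card sub) (leq_imset_card _ _).
rewrite cardsX => le; have := cardsID I M.
rewrite (setIidPr IM) cI; nia.
Qed.

(** An edge disjoint from the union of a maximal matching could be added to
    it. *)
Lemma small_transversal : matching_free s G ->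
  exists2 T : {set G}, #|T| <= transversal_bound s & transversal T.
Proof.
move=> Gfree.
pose P (M : {set {set G}}) := (M \subset edges G) && trivIset M.
have [|M /maxsetP[/andP[ME triv] Mmax]] := @ex_maxset _ P.
  by exists set0; rewrite /P sub0set; apply/trivIsetP => A B; rewrite inE.
exists (cover M).
  apply: leq_trans (card_cover_edges ME) _; rewrite leq_pmul2l //.
  rewrite leqNgt; apply/negP => big.
  have [I [IM cI isoI]] := large_matching_isolated ME triv (ltnW big).
  apply: (Gfree (cover I)); apply: isolated_matching_isomorphic => //.
    exact: subset_trans IM ME.
  exact: trivIsetS IM triv.
move=> e eE; apply/negP => dis.
have eM : {in M, forall f : {set G}, [disjoint e & f]}.
  by move=> f fM; apply: disjointWr dis; apply: bigcup_sup.
have M0 : set0 \notin M by apply: contra (@edges_neq0 G) => /(subsetP ME).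
have [triv' /negP[]] := trivIsetU1 eM triv M0.
rewrite -(Mmax (e |: M)) ?setU11 ?subsetUr //.
by rewrite /P subUset sub1set eE ME.
Qed.

End Transversal.

(** * Two-satisfiability *)

(** A literal [(v, b)] asserts that the variable [v] has the value [b]. *)
Definition negate (T : Type) (l : T * bool) : T * bool := (l.1, ~~ l.2).

Definition satisfies (T : Type) (e : rel (T * bool)) (c : T -> bool) : Prop :=
  forall l l', e l l' -> c l.1 = l.2 -> c l'.1 = l'.2.

Section TwoSat.

Variables (T : finType) (e : rel (T * bool)).
Hypothesis skew : forall l l', e l l' -> e (negate l') (negate l).

Let negateK : involutive (@negate T).
Proof. by move=> [v b]; rewrite /negate /= negbK. Qed.

Lemma connect_skew l l' : connect e l l' -> connect e (negate l') (negate l).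
Proof.
case/connectP => p ep ->; elim: p l ep => [|l1 p IH] l /=; first by rewrite connect0.
case/andP => /skew el /IH cp; exact: connect_trans cp (connect1 el).
Qed.

Lemma satisfies_connect c l l' :
  satisfies e c -> connect e l l' -> c l.1 = l.2 -> c l'.1 = l'.2.
Proof.
move=> sat /connectP[p ep ->]; elim: p l ep => //= l1 p IH l /andP[el ep] cl.
by apply: IH ep _; apply: sat el cl.
Qed.

(** A maximal set of literals that is consistent and closed under implication
    decides every variable: if it left [v] open, one of the two literals of
    [v] would not imply its own negation, and its consequences could be
    added. *)
Lemma two_sat :
  (forall v, ~~ (connect e (v, true) (v, false) && connect e (v, false) (v, true))) ->
  exists c, satisfies e c.
Proof.
move=> ncyc.
pose good (S : {set T * bool}) :=
  [forall l in S, (negate l \notin S) && [forall l', e l l' ==> (l' \in S)]].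
have [|S /maxsetP[/forall_inP goodS maxS]] := @ex_maxset _ good.
  by exists set0; apply/forall_inP => l; rewrite inE.
have closed l l' : l \in S -> connect e l l' -> l' \in S.
  move=> lS /connectP[p ep ->]; elim: p l lS ep => //= l1 p IH l lS /andP[el ep].
  by apply: IH ep; have /andP[_ /forallP/(_ l1)/implyP] := goodS l lS; apply.
have add l : ~~ connect e l (negate l) -> (l \in S) || (negate l \in S).
  move=> nl; apply/norP => -[lS nlS]; case/negP: lS.
  pose R := [set l' | connect e l l'].
  suff <- : S :|: R = S by rewrite !inE connect0 orbT.
  apply: maxS; last exact: subsetUl.
  apply/forall_inP => l1 l1SR; apply/andP; split.
    apply/negP => nl1SR; case/setUP: l1SR => [l1S | l1R].
      case/setUP: nl1SR => [|nl1R]; first by apply/negP; case/andP: (goodS _ l1S).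
      rewrite inE in nl1R; move/connect_skew: nl1R; rewrite negateK => cl1.
      by case/negP: nlS; apply: closed cl1.
    rewrite inE in l1R; case/setUP: nl1SR => [nl1S | nl1R].
      move/connect_skew: l1R => cl1; case/negP: nlS; exact: closed cl1.
    rewrite inE in nl1R; case/negP: nl; apply: connect_trans l1R _.
    by rewrite -(negateK l1); apply: connect_skew.
  apply/forallP => l2; apply/implyP => el; case/setUP: l1SR => [l1S | l1R].
    by rewrite inE (closed l1 l2) // connect1.
  by rewrite !inE in l1R *; rewrite (connect_trans l1R (connect1 el)) orbT.
have decided v : ((v, true) \in S) || ((v, false) \in S).
  have := ncyc v; rewrite negb_and => /orP[/add // | /add]; by rewrite orbC.
exists (fun v => (v, true) \in S) => -[v b] [v' b'] /= el cv.
have lS : (v, b) \in S.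
  by case: b {el} cv => // vS; have := decided v; rewrite vS.
have {el} : (v', b') \in S by apply: closed lS (connect1 el).
by case: b' => // /[dup] /goodS /andP[/negPf].
Qed.

End TwoSat.

(** * Colourings and two-satisfiability *)

Section Coloring.

Variable G : hypergraph.
Hypothesis G3 : three_uniform G.

Definition triple (u v w : G) : bool :=
  [&& u != v, u != w, v != w & [set u; v; w] \in edges G].

Lemma tripleP e u : e \in edges G -> u \in e ->
  exists v w, triple u v w /\ e = [set u; v; w].
Proof.
move=> eE ue; have /eqP/cards2P[v [w [vw evw]]] : #|e :\ u| = 2.
  by have := G3 eE; rewrite (cardsD1 u) ue => -[].
have eq : e = [set u; v; w] by rewrite -(setD1K ue) evw setUA.
exists v, w; rewrite /triple -eq eE vw andbT; split=> //.
have : u \notin e :\ u by rewrite !inE eqxx.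
by rewrite evw !inE negb_or => /andP[-> ->].
Qed.

Lemma triple_swap u v w : triple u v w -> triple u w v.
Proof.
by case/and4P => uv uw vw; rewrite /triple uv uw (eq_sym w) vw setUAC.
Qed.

Variable F : bool -> pred G.

(** An edge containing a vertex coloured [b] may not contain two more vertices
    coloured [b], and a vertex that must be coloured [b] may not be coloured
    otherwise; a literal is a vertex together with a colour. *)
Definition implication : rel (G * bool) := fun l l' =>
  (l'.2 == ~~ l.2) && ([exists a, F l.2 a && triple a l.1 l'.1]
                       || (l.1 == l'.1) && F l'.2 l.1).

Lemma implication_skew l l' :
  implication l l' -> implication (negate l') (negate l).
Proof.
case: l l' => [u b] [w _] /andP[/eqP/= -> uw]; rewrite /implication /negate !negbK.
rewrite [_ == ~~ b]eqxx /=; case/orP: uw => [/existsP[a /andP[Fa auw]] | /andP[/eqP<- Fu]].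
  by apply/orP; left; apply/existsP; exists a; rewrite Fa triple_swap.
by rewrite eqxx Fu orbT.
Qed.

(** Two more vertices of colour [b] would make the edge monochromatic. *)
Lemma coloring_satisfies c :
  two_coloring c -> (forall b v, F b v -> c v = b) -> satisfies implication c.
Proof.
move=> col Fc [u b] [w _] /andP[/eqP/= ->].
case/orP => [/existsP[a /andP[Fa auw]] | /andP[/eqP <- /Fc //]] cu.
case: (eqVneq (c w) b) => [cw | ]; last by case: (c w) (b) => -[].
case/and4P: auw => _ _ _ /(col b)/negP[].
apply/subsetP => x; rewrite !inE -orbA => /or3P[] /eqP->.
- by rewrite (Fc _ _ Fa).
- by rewrite cu.
- by rewrite cw.
Qed.

Lemma satisfies_forced c b v : satisfies implication c -> F b v -> c v = b.
Proof.
move=> sat Fv; case: (eqVneq (c v) b) => // ne.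
have e1 : implication (v, ~~ b) (v, b).
  by rewrite /implication /= negbK !eqxx Fv orbT.
by apply: sat e1 _; move: ne => /=; case: (c v); case: (b).
Qed.

(** Every edge has a vertex [a] whose colour [b] is forced. If the edge were
    monochromatic, one of its two other vertices would have colour [b], and
    would imply that the last one does not. *)
Lemma satisfies_coloring c :
  (forall e, e \in edges G -> exists b a, F b a /\ a \in e) ->
  satisfies implication c -> two_coloring c.
Proof.
move=> hit sat b' e eE; apply/negP => /subsetP mono.
have [b [a [Fa ae]]] := hit e eE.
have [u [w [auw e3]]] := tripleP eE ae.
have cE x : x \in e -> c x = b.
  move=> /mono; rewrite inE => /eqP ->; have := mono a ae; rewrite inE => /eqP <-.
  exact: satisfies_forced.
have e1 : implication (u, b) (w, ~~ b).
  by rewrite /implication /= eqxx; apply/orP; left; apply/existsP; exists a; rewrite Fa.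
have := sat _ _ e1; rewrite /= !cE ?e3 ?inE ?eqxx ?orbT // => /(_ erefl).
by case: (b).
Qed.

End Coloring.

(** * The search on vertex numbers *)

Definition literal (u : nat) (b : bool) : nat := u + u + b.

Lemma literal_inj u v b c : literal u b = literal v c -> u = v /\ b = c.
Proof. by rewrite /literal; case: b c => -[]; lia. Qed.

Definition forced (pre : bool -> pred nat) (s t : seq nat) (b : bool) : pred nat :=
  fun u => (u \in if b then s else t) || pre b u.

(** The vertices and the colour of the literals [l] and [l'] are searched for
    instead of being decoded; [implies] is the counterpart on numbers of
    [implication]. *)
Definition implies_at (N : nat) (E : nat -> nat -> nat -> bool)
    (F : bool -> pred nat) (l l' u w : nat) (b : bool) : bool :=
  [&& l == literal u b, l' == literal w (~~ b)
    & has (fun a => F b a && E a u w) (iota 0 N) || (u == w) && F (~~ b) u].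

Definition implies (N : nat) (E : nat -> nat -> nat -> bool)
    (F : bool -> pred nat) : rel nat := fun l l' =>
  has (fun u => has (fun w =>
    implies_at N E F l l' u w true || implies_at N E F l l' u w false)
  (iota 0 N)) (iota 0 N).

Definition consistent (N n : nat) (e : rel nat) : bool :=
  all (fun u => (u < n) ==>
    ~~ (reach N e (literal u true) (literal u false)
        && reach N e (literal u false) (literal u true))) (iota 0 N).

Definition covers (N : nat) (E : nat -> nat -> nat -> bool) (s : seq nat) : bool :=
  all (fun u => all (fun v => all (fun w =>
    E u v w ==> [|| u \in s, v \in s | w \in s])
  (iota 0 N)) (iota 0 N)) (iota 0 N).

(** The vertices of a small transversal are guessed together with their
    colours: [s] lists those of colour [true], and [t] those of colour
    [false]. *)
Definition extendable (k N n : nat) (E : nat -> nat -> nat -> bool)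
    (pre : bool -> pred nat) : bool :=
  exists_tuple N k (fun s => exists_tuple N k (fun t =>
    covers N E (s ++ t) && consistent N n (implies N E (forced pre s t)))).

Definition candidate (N n : nat) (E : nat -> nat -> nat -> bool) (s : seq nat) : nat :=
  if covers N E s then (word N (fun v => (v < n) && (v \notin s))).+1 else 0.

(** The value is the successor of the word of the complement of a smallest
    transversal, or [0] if no transversal has at most [k] elements: tuples are
    tried by increasing length. *)
Fixpoint best (k N n : nat) (E : nat -> nat -> nat -> bool) : nat :=
  if k is k'.+1 then
    if best k' N n E != 0 then best k' N n E else max_tuple N k (candidate N n E)
  else max_tuple N 0 (candidate N n E).

Section Numbering.

Variables (G : hypergraph) (vs : seq G) (N : nat) (E : nat -> nat -> nat -> bool).
Hypotheses (G3 : three_uniform G) (vsP : perm_eq vs (enum [set: G])).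
Hypothesis N_ge : #|G|.*2 < N.

Let idx (v : G) := index v vs.
Hypothesis EP : forall u v w, E (idx u) (idx v) (idx w) = triple u v w.
Hypothesis E_lt : forall u v w, E u v w -> [&& u < #|G|, v < #|G| & w < #|G|].

Lemma size_numbering : size vs = #|G|.
Proof. by rewrite (perm_size vsP) -cardE cardsT. Qed.

Lemma uniq_numbering : uniq vs.
Proof. by rewrite (perm_uniq vsP) enum_uniq. Qed.

Lemma mem_numbering v : v \in vs.
Proof. by rewrite (perm_mem vsP) mem_enum inE. Qed.

Lemma idx_lt v : idx v < #|G|.
Proof. by rewrite -size_numbering index_mem mem_numbering. Qed.

Lemma idx_inj : injective idx.
Proof.
move=> u v uv; rewrite -(nth_index u (mem_numbering u)) -/(idx u) uv.
by rewrite nth_index // mem_numbering.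
Qed.

Lemma idx_surj u : u < #|G| -> exists v, idx v = u.
Proof.
move=> ult; have /card_gt0P[v0 _] := leq_ltn_trans (leq0n u) ult.
by exists (nth v0 vs u); rewrite /idx index_uniq ?uniq_numbering ?size_numbering.
Qed.

Lemma idx_bound v : idx v < N.
Proof. by have := idx_lt v; lia. Qed.

Lemma coversP s :
  reflect (forall e, e \in edges G -> exists2 v, v \in e & idx v \in s)
          (covers N E s).
Proof.
apply: (iffP idP) => [cov e eE | hit].
  have [u ue] : exists u, u \in e.
    by apply/set0Pn; rewrite -card_gt0 (G3 eE).
  have [v [w [t eq]]] := tripleP G3 eE ue.
  move: cov => /allP/(_ (idx u)); rewrite mem_iota idx_bound => /(_ isT).
  move=> /allP/(_ (idx v)); rewrite mem_iota idx_bound => /(_ isT).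
  move=> /allP/(_ (idx w)); rewrite mem_iota idx_bound EP t => /(_ isT).
  rewrite eq => /or3P[] ins.
  - by exists u; rewrite // !inE eqxx.
  - by exists v; rewrite // !inE eqxx orbT.
  - by exists w; rewrite // !inE eqxx orbT.
apply/allP => i _; apply/allP => j _; apply/allP => k _; apply/implyP => Eijk.
have /and3P[/idx_surj[u iE] /idx_surj[v jE] /idx_surj[w kE]] := E_lt Eijk.
move: Eijk; rewrite -iE -jE -kE EP => /and4P[_ _ _ /hit[x]].
by rewrite !inE -orbA => /or3P[] /eqP-> ->; rewrite ?orbT.
Qed.

(** A tuple longer than the set that it lists is padded with the number [#|G|],
    which belongs to no vertex. *)
Lemma tuple_of_set k (S : {set G}) : #|S| <= k ->
  exists s, [/\ size s = k, all (gtn N) s & forall v, (idx v \in s) = (v \in S)].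
Proof.
move=> Sk; exists ([seq idx v | v <- enum S] ++ nseq (k - #|S|) #|G|); split.
- by rewrite size_cat size_map -cardE size_nseq subnKC.
- rewrite all_cat; apply/andP; split.
    by apply/allP => _ /mapP[v _ ->]; apply: idx_bound.
  apply/allP => x; rewrite mem_nseq => /andP[_ /eqP->].
  change (#|G| < N); lia.
move=> v; rewrite mem_cat mem_map; last exact: idx_inj.
rewrite mem_enum mem_nseq; have := idx_lt v; case: eqP => [->|]; lia.
Qed.

Section Implications.

Variables (F : bool -> pred nat) (FG : bool -> pred G).
Hypothesis FP : forall b v, F b (idx v) = FG b v.

Let lit (l : G * bool) : nat := literal (idx l.1) l.2.

Lemma lit_lt l : lit l < N.
Proof. by have := idx_lt l.1; rewrite /lit /literal; case: (l.2); lia. Qed.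

Lemma implies_lit l l' : implies N E F (lit l) (lit l') = implication FG l l'.
Proof.
apply/idP/idP.
  case/hasP => u _ /hasP[w _] uw.
  have {uw} [b] : exists b, implies_at N E F (lit l) (lit l') u w b.
    by case/orP: uw; [exists true | exists false].
  case/and3P => /eqP/literal_inj[<- <-] /eqP/literal_inj[<- eb].
  rewrite /implication eb eqxx /= => /orP[/hasP[i _ /andP[Fi Eiuw]] | ].
    have /and3P[/idx_surj[a iE] _ _] := E_lt Eiuw.
    rewrite -iE EP FP in Fi Eiuw.
    by apply/orP; left; apply/existsP; exists a; rewrite Fi.
  by case/andP => /eqP/idx_inj->; rewrite FP => ->; rewrite eqxx orbT.
case/andP => /eqP eb step; apply/hasP; exists (idx l.1).
  by rewrite mem_iota idx_bound.
apply/hasP; exists (idx l'.1); first by rewrite mem_iota idx_bound.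
suff : implies_at N E F (lit l) (lit l') (idx l.1) (idx l'.1) l.2.
  by case: (l.2) => ->; rewrite ?orbT.
rewrite /implies_at /lit eb !eqxx /=.
case/orP: step => [/existsP[a /andP[Fa aE]] | /andP[/eqP<-]].
  apply/orP; left; apply/hasP; exists (idx a); first by rewrite mem_iota idx_bound.
  by rewrite FP Fa EP.
by rewrite eb eqxx FP => ->; rewrite orbT.
Qed.

Lemma implies_image l x : implies N E F (lit l) x -> exists l', x = lit l'.
Proof.
case/hasP => u _ /hasP[w _] uw.
have {uw} [b] : exists b, implies_at N E F (lit l) x u w b.
  by case/orP: uw; [exists true | exists false].
case/and3P => /eqP/literal_inj[<- _] /eqP-> /orP[/hasP[i _ /andP[_ /E_lt]] | ].
  by case/and3P => _ _ /idx_surj[v <-]; exists (v, ~~ b).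
by case/andP => /eqP<- _; exists (l.1, ~~ b).
Qed.

(** The literals on vertices are closed under [implies], so that paths on
    numbers and paths in the implication graph correspond. *)
Lemma reach_lit l l' :
  reach N (implies N E F) (lit l) (lit l') = connect (implication FG) l l'.
Proof.
apply/(reachP _ _ (lit_lt l))/connectP => [[p [ep lp _]] | [p ep ->]].
  elim: p l ep lp => [|x p IH] l /=.
    move=> _ /literal_inj[/idx_inj]; case: l l' => u b [v c] /= -> ->.
    by exists [::].
  case/andP => /[dup] /implies_image[l1 ->]; rewrite implies_lit => el ep lp.
  have [q eq lq] := IH l1 ep lp.
  by exists (l1 :: q) => //=; rewrite el.
exists (map lit p); split; last by apply/allP => _ /mapP[q _ ->]; apply: lit_lt.
  rewrite path_map; apply: sub_path ep => x y; by rewrite -implies_lit.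
by rewrite last_map.
Qed.

Lemma consistentP :
  reflect (forall v, ~~ (connect (implication FG) (v, true) (v, false) &&
                         connect (implication FG) (v, false) (v, true)))
          (consistent N #|G| (implies N E F)).
Proof.
apply: (iffP allP) => [cons v | cons i _].
  have := cons (idx v); rewrite mem_iota idx_bound idx_lt => /(_ isT).
  by rewrite -[literal _ true]/(lit (v, true)) -[literal _ false]/(lit (v, false)) !reach_lit.
apply/implyP => /idx_surj[v <-]; have := cons v.
by rewrite -[literal _ true]/(lit (v, true)) -[literal _ false]/(lit (v, false)) !reach_lit.
Qed.

End Implications.

(** A colouring is found from the colours that it gives to the vertices of a
    small transversal [T]. Conversely, any guess accepted by the search gives a
    satisfiable set of implications, hence a colouring. *)
Lemma extendableP k (pre : bool -> pred nat) (preG : bool -> pred G) (T : {set G}) :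
  (forall b v, pre b (idx v) = preG b v) ->
  #|T| <= k -> transversal T ->
  extendable k N #|G| E pre <->
  exists2 c : G -> bool, two_coloring c & forall b v, preG b v -> c v = b.
Proof.
move=> preP Tk hitT; split.
  case/exists_tupleP => s [_ _ /exists_tupleP[t [_ _ /andP[/coversP cov cons]]]].
  pose FG b (v : G) := (idx v \in if b then s else t) || preG b v.
  have FP b v : forced pre s t b (idx v) = FG b v by rewrite /forced preP.
  have [c sat] := two_sat (@implication_skew G FG) (elimT (consistentP FP) cons).
  exists c; last by move=> b v pv; apply: satisfies_forced sat _; rewrite /FG pv orbT.
  apply: (satisfies_coloring G3 _ sat) => e /cov[v ve].
  rewrite mem_cat => /orP[] vst; first by exists true, v; rewrite /FG vst.
  by exists false, v; rewrite /FG vst.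
case=> c col precol.
have tuple_color b : exists s, [/\ size s = k, all (gtn N) s &
    forall v, (idx v \in s) = (v \in T) && (c v == b)].
  have [|s [sk sN sP]] := @tuple_of_set k [set v in T | c v == b].
    apply: leq_trans Tk; apply: subset_leq_card; apply/subsetP => v.
    by rewrite inE => /andP[].
  by exists s; split=> // v; rewrite sP inE.
have [s [sk sN sP]] := tuple_color true.
have [t [tk tN tP]] := tuple_color false.
apply/exists_tupleP; exists s; split=> //.
apply/exists_tupleP; exists t; split=> //; apply/andP; split.
  apply/coversP => e /hitT; case/pred0Pn => v /andP[/= ve vT]; exists v => //.
  by rewrite mem_cat sP tP vT; case: (c v).
pose FG b (v : G) := (idx v \in if b then s else t) || preG b v.
have FP b v : forced pre s t b (idx v) = FG b v by rewrite /forced preP.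
apply/(consistentP FP) => v; apply/negP => /andP[ct cf].
have sat : satisfies (implication FG) c.
  apply: coloring_satisfies => // b w /orP[|/precol //].
  by case: b; rewrite ?sP ?tP => /andP[_ /eqP].
have := satisfies_connect sat ct; have := satisfies_connect sat cf => /=.
by case: (c v) => [_ /(_ erefl) | /(_ erefl)].
Qed.

Lemma max_tuple_candidate_eq0 k (T : {set G}) : transversal T ->
  max_tuple N k (candidate N #|G| E) = 0 -> k < #|T|.
Proof.
move=> hitT max0; rewrite ltnNge; apply/negP => /tuple_of_set[s [sk sN sP]].
have := leq_max_tuple (candidate N #|G| E) sk sN; rewrite max0 /candidate.
suff -> : covers N E s by [].
apply/coversP => e /hitT/pred0Pn[v /andP[/= ve vT]].
by exists v; rewrite // sP.
Qed.

Lemma best_eq0 k (T : {set G}) : transversal T -> best k N #|G| E = 0 -> k < #|T|.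
Proof.
move=> hitT; case: k => [|k] /=; first exact: (@max_tuple_candidate_eq0 0 T).
by case: eqP => // _; apply: (@max_tuple_candidate_eq0 k.+1 T).
Qed.

Lemma best_neq0 k : best k N #|G| E != 0 ->
  exists s, [/\ covers N E s,
    best k N #|G| E = (word N (fun v => (v < #|G|) && (v \notin s))).+1
    & forall T : {set G}, transversal T -> size s <= #|T|].
Proof.
have attained j : max_tuple N j (candidate N #|G| E) != 0 ->
    (forall T : {set G}, transversal T -> j <= #|T|) ->
  exists s, [/\ covers N E s, max_tuple N j (candidate N #|G| E) =
      (word N (fun v => (v < #|G|) && (v \notin s))).+1
    & forall T : {set G}, transversal T -> size s <= #|T|].
  move=> nz min; have [s [sj _ es]] := max_tuple_attained nz.
  exists s; rewrite sj -es; rewrite -es /candidate in nz *.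
  by case: ifP nz.
elim: k => [|k IH] /= nz; first exact: (attained 0).
case: (eqVneq (best k N #|G| E) 0) nz => [best0 nz | nz _]; last exact: IH.
by apply: (attained k.+1) => // T hitT; apply: best_eq0 best0.
Qed.

(** A larger stable set would have a complement that is a transversal with fewer
    elements than [s] has entries. *)
Lemma covers_max_stable s : covers N E s ->
  (forall T : {set G}, transversal T -> size s <= #|T|) ->
  max_stable [set v | idx v \notin s].
Proof.
move=> /coversP cov min; split=> [e /cov[v ve vs'] | S' stS'].
  by apply/negP => /subsetP/(_ v ve); rewrite inE vs'.
have : size s <= #|~: S'|.
  apply: min => e /stS' /subsetPn[v ve vS'].
  by apply/pred0Pn; exists v; rewrite /= ve inE.
have : #|~: [set v | idx v \notin s]| <= size s.
  rewrite cardE -(size_map idx); apply: uniq_leq_size.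
    by rewrite map_inj_uniq ?enum_uniq //; apply: idx_inj.
  by move=> _ /mapP[v vS ->]; move: vS; rewrite mem_enum !inE negbK.
have := cardsC S'; have := cardsC [set v | idx v \notin s]; lia.
Qed.

End Numbering.

(** * The search is computable *)

Section SearchComputable.

Variables (A : Type) (cells : A -> nat -> nat) (bound n : A -> nat).
Variables (E : A -> nat -> nat -> nat -> bool) (pre : A -> bool -> pred nat).

Local Notation comp := (@computable A cells bound _).
Implicit Types C : ctx A.

Hypothesis comp_n : forall C, comp (fun a : C => n (root a)).
Hypothesis comp_E : forall C (f g h : C -> nat), comp f -> comp g -> comp h ->
  comp (fun a : C => E (root a) (f a) (g a) (h a)).
Hypothesis comp_pre : forall C b (f : C -> nat), comp f ->
  comp (fun a : C => pre (root a) b (f a)).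

Lemma computable_seq_cat C (s t : C -> seq nat) :
  computable_seq cells bound s -> computable_seq cells bound t ->
  computable_seq cells bound (fun a => s a ++ t a).
Proof.
by move=> cs ct; elim: cs => [|f {}s cf _ IH] //; apply: (ComputableCons cf IH).
Qed.

Lemma computable_literal C (f : C -> nat) (b : bool) :
  comp f -> comp (fun a => literal (f a) b).
Proof.
move=> cf; apply: computable_add; first exact: computable_add.
exact: computable_const.
Qed.

Lemma computable_covers C (s : C -> seq nat) :
  computable_seq cells bound s ->
  comp (fun a => covers (bound (root a)) (E (root a)) (s a)).
Proof.
move=> cs; do 3!apply: computable_all.
have c0 : comp (fun a : extend (extend (extend C)) => a.2) by apply: computable_var.
have c1 : comp (fun a : extend (extend (extend C)) => a.1.2).
  exact: computable_weaken (computable_var _ _ _).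
have c2 : comp (fun a : extend (extend (extend C)) => a.1.1.2).
  exact: computable_weaken (computable_weaken (computable_var _ _ _)).
have cs3 := computable_seq_weaken (computable_seq_weaken (computable_seq_weaken cs)).
apply: (@eq_computable _ _ _ _ (fun a : extend (extend (extend C)) =>
  ~~ E (root a) a.1.1.2 a.1.2 a.2 ||
  [|| a.1.1.2 \in s a.1.1.1, a.1.2 \in s a.1.1.1 | a.2 \in s a.1.1.1])).
  by move=> a; rewrite implybE.
apply: computable_orb; first by apply: computable_negb; apply: comp_E.
by do 2?apply: computable_orb; apply: computable_mem.
Qed.

Lemma computable_forced C (s t : C -> seq nat) (f : C -> nat) (b : bool) :
  computable_seq cells bound s -> computable_seq cells bound t -> comp f ->
  comp (fun a => forced (pre (root a)) (s a) (t a) b (f a)).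
Proof.
move=> cs ct cf; apply: computable_orb; last exact: comp_pre.
by case: b; apply: computable_mem.
Qed.

Lemma computable_implies C (s t : C -> seq nat) (f g : C -> nat) :
  computable_seq cells bound s -> computable_seq cells bound t ->
  comp f -> comp g ->
  comp (fun a => implies (bound (root a)) (E (root a))
                   (forced (pre (root a)) (s a) (t a)) (f a) (g a)).
Proof.
move=> cs ct cf cg; do 2!apply: computable_has.
have {cs}cs := computable_seq_weaken (computable_seq_weaken cs).
have {ct}ct := computable_seq_weaken (computable_seq_weaken ct).
have {cf}cf := computable_weaken (computable_weaken cf).
have {cg}cg := computable_weaken (computable_weaken cg).
have cw : comp (fun a : extend (extend C) => a.2) by apply: computable_var.
have cu : comp (fun a : extend (extend C) => a.1.2).
  exact: computable_weaken (computable_var _ _ _).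
suff cb b : comp (fun a : extend (extend C) => implies_at (bound (root a)) (E (root a))
    (forced (pre (root a)) (s a.1.1) (t a.1.1)) (f a.1.1) (g a.1.1) a.1.2 a.2 b).
  by apply: computable_orb; apply: cb.
apply: computable_andb; first exact: (computable_eqn cf (computable_literal _ cu)).
apply: computable_andb; first exact: (computable_eqn cg (computable_literal _ cw)).
apply: computable_orb; last first.
  by apply: computable_andb; [apply: computable_eqn | apply: (computable_forced _ cs ct)].
apply: computable_has; apply: computable_andb.
  apply: (computable_forced _ (computable_seq_weaken cs) (computable_seq_weaken ct)).
  exact: computable_var.
exact: (comp_E (computable_var _ _ _) (computable_weaken cu) (computable_weaken cw)).
Qed.

Lemma computable_consistent C (s t : C -> seq nat) :
  computable_seq cells bound s -> computable_seq cells bound t ->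
  comp (fun a => consistent (bound (root a)) (n (root a))
    (implies (bound (root a)) (E (root a)) (forced (pre (root a)) (s a) (t a)))).
Proof.
move=> cs ct; apply: computable_all.
have cu := computable_var cells bound C.
pose e (a : extend C) := implies (bound (root a)) (E (root a))
  (forced (pre (root a)) (s a.1) (t a.1)).
have ce b c : comp (fun a : extend C =>
    reach (bound (root a)) (e a) (literal a.2 b) (literal a.2 c)).
  apply: computable_reach; try exact: (computable_literal _ cu).
  apply: (@computable_implies (extend (extend (extend (extend (extend C)))))
    (fun a => s a.1.1.1.1.1) (fun a => t a.1.1.1.1.1) (fun a => a.2) (fun a => a.1.2)).
  - exact: (computable_seq_weaken (computable_seq_weaken (computable_seq_weaken
      (computable_seq_weaken (computable_seq_weaken cs))))).
  - exact: (computable_seq_weaken (computable_seq_weaken (computable_seq_weaken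
      (computable_seq_weaken (computable_seq_weaken ct))))).
  - exact: computable_var.
  - exact: computable_weaken (computable_var _ _ _).
apply: (@eq_computable _ _ _ (extend C) (fun a : extend C => ~~ (a.2 < n (root a)) ||
  ~~ (reach (bound (root a)) (e a) (literal a.2 true) (literal a.2 false) &&
      reach (bound (root a)) (e a) (literal a.2 false) (literal a.2 true)))).
  by move=> a; rewrite implybE.
apply: computable_orb.
  by apply: computable_negb; apply: computable_leq => //; apply: computable_succ.
by apply: computable_negb; apply: computable_andb.
Qed.

Lemma computable_extendable C k :
  comp (fun a : C => extendable k (bound (root a)) (n (root a)) (E (root a)) (pre (root a))).
Proof.
apply: computable_exists_tuple; set D := extend_by k C.
pose check (r : A) s t := covers (bound r) (E r) (s ++ t) &&
  consistent (bound r) (n r) (implies (bound r) (E r) (forced (pre r) s t)).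
apply: (@eq_computable _ _ _ D (fun a =>
  exists_tuple (bound (root a)) k (check (root a) (tuple_of a)))).
  by move=> a; rewrite root_base.
apply: computable_exists_tuple.
apply: (@eq_computable _ _ _ (extend_by k D) (fun a =>
  check (root a) (tuple_of (base a)) (tuple_of a))).
  by move=> a; rewrite root_base.
have cs := computable_seq_base k (computable_tuple_of cells bound C k).
have ct := computable_tuple_of cells bound D k.
apply: computable_andb; last exact: computable_consistent.
exact: (computable_covers (computable_seq_cat cs ct)).
Qed.

Lemma computable_candidate C (s : C -> seq nat) :
  computable_seq cells bound s ->
  comp (fun a => candidate (bound (root a)) (n (root a)) (E (root a)) (s a)).
Proof.
move=> cs; apply: computable_if; first exact: computable_covers.
  apply: computable_succ; apply: computable_word.
  have cv := computable_var cells bound C.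
  apply: computable_andb; first by apply: computable_leq => //; apply: computable_succ.
  by apply: computable_negb; apply: (computable_mem cv (computable_seq_weaken cs)).
exact: computable_const.
Qed.

Lemma computable_best C k :
  comp (fun a : C => best k (bound (root a)) (n (root a)) (E (root a))).
Proof.
have step j : comp (fun a : C =>
    max_tuple (bound (root a)) j (candidate (bound (root a)) (n (root a)) (E (root a)))).
  apply: computable_max_tuple.
  apply: (@eq_computable _ _ _ (extend_by j C) (fun a =>
    candidate (bound (root a)) (n (root a)) (E (root a)) (tuple_of a))).
    by move=> a; rewrite root_base.
  by apply: computable_candidate; apply: computable_tuple_of.
elim: k => [|k IH]; first exact: (step 0).
apply: computable_if; [|exact: IH | exact: (step k.+1)].
apply: computable_negb; apply: computable_eqn => //; exact: computable_const.
Qed.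

End SearchComputable.

(** * Reading the input *)

Lemma nth_flatten_uniform (T : Type) (x0 : T) n (ss : seq (seq T)) j i :
  all (fun s => size s == n) ss -> i < n ->
  nth x0 (flatten ss) (n * j + i) = nth x0 (nth [::] ss j) i.
Proof.
move=> + ilt; elim: ss j => [|s ss IH] j /=; first by rewrite !nth_nil.
case/andP => /eqP sn ssn; rewrite nth_cat sn; case: j => [|j].
  by rewrite muln0 add0n ilt.
by rewrite ifF; [rewrite mulnS -addnA addKn IH | lia].
Qed.

(** The three problems encode an instance by the number of vertices in unary,
    [x] words of one bit per vertex, and the edges. *)
Section Reading.

Variables (A : Type) (G : A -> input3) (w extra : A -> seq bool) (x : nat).
Hypothesis wE : forall a, w a = encode_order (G a) ++ extra a ++ encode_edges (G a).
Hypothesis size_extra : forall a, size (extra a) = #|G a| * x.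

Let cells (a : A) (i : nat) : nat := nth false (w a) i.
Let bound (a : A) : nat := (size (w a)).*2.+2.
Local Notation comp := (@computable A cells bound _).
Implicit Types C : ctx A.

Lemma size_encode_order (H : input3) : size (encode_order H) = #|H|.+1.
Proof. by rewrite size_rcons size_nseq. Qed.

Lemma size_encode_set (H : input3) (S : {set H}) : size (encode_set S) = #|H|.
Proof. by rewrite /encode_set size_map (size_numbering (vertex_listP H)). Qed.

Lemma size_word a :
  size (w a) = #|G a|.+1 + #|G a| * x + #|G a| * size (edge_list (G a)).
Proof.
rewrite wE !size_cat size_encode_order size_extra addnA; congr (_ + _).
rewrite /encode_edges; elim: (edge_list _) => [|e s IH] /=; first by rewrite muln0.
by rewrite size_cat IH size_encode_set mulnS.
Qed.

Lemma order_lt_bound a : #|G a|.*2 < bound a.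
Proof. by rewrite /bound size_word; lia. Qed.

Lemma cells_order a i : i <= #|G a| -> cells a i = (i < #|G a|).
Proof.
move=> ile; rewrite /cells wE nth_cat size_encode_order ltnS ile nth_rcons size_nseq.
by rewrite nth_nseq; case: ltnP => // _; rewrite if_same.
Qed.

Lemma cells_extra a i : i < #|G a| * x -> cells a (#|G a|.+1 + i) = nth false (extra a) i.
Proof.
move=> ilt; rewrite /cells wE nth_cat size_encode_order ltnNge leq_addr /= addKn.
by rewrite nth_cat size_extra ilt.
Qed.

Lemma cells_edges a j v :
  cells a (#|G a|.+1 + #|G a| * x + #|G a| * j + index v (vertex_list (G a)))
    = (v \in nth set0 (edge_list (G a)) j).
Proof.
rewrite /cells wE nth_cat size_encode_order ifF; last by lia.
rewrite nth_cat size_extra ifF; last by lia.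
set k := (X in nth _ _ X).
have -> : k = #|G a| * j + index v (vertex_list (G a)) by rewrite /k; lia.
have vlt := idx_lt (vertex_listP (G a)) v.
rewrite nth_flatten_uniform //; last first.
  by apply/allP => _ /mapP[e _ ->]; rewrite size_encode_set.
have [jlt | jge] := ltnP j (size (edge_list (G a))).
  rewrite (nth_map set0) // (nth_map v) ?nth_index ?(mem_numbering (vertex_listP _)) //.
  by rewrite index_mem (mem_numbering (vertex_listP _)).
by rewrite (nth_default set0 jge) inE (nth_default [::]) ?nth_nil // size_map.
Qed.

(** A number [l] that is not the number of an edge leads to cells beyond the
    input, which are null. *)
Definition edge_at a (i j k : nat) : bool :=
  [&& i < #|G a|, j < #|G a|, k < #|G a|, i != j, i != k, j != k
    & has (fun l => let o := #|G a|.+1 + #|G a| * x + #|G a| * l in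
        [&& cells a (o + i) != 0, cells a (o + j) != 0 & cells a (o + k) != 0])
      (iota 0 (bound a))].

Lemma edge_at_lt a i j k :
  edge_at a i j k -> [&& i < #|G a|, j < #|G a| & k < #|G a|].
Proof. by case/and4P => -> -> ->. Qed.

Lemma edge_at_triple a (t u v : G a) (idx := index^~ (vertex_list (G a))) :
  edge_at a (idx t) (idx u) (idx v) = triple t u v.
Proof.
have inj : injective idx by apply: idx_inj (vertex_listP _).
have lt : forall v, idx v < #|G a| := idx_lt (vertex_listP (G a)).
rewrite /edge_at; move Er: (iota _ _) => r; rewrite !lt /= !(inj_eq inj) /triple.
case: eqVneq => //= tu; case: eqVneq => //= tv; case: eqVneq => //= uv.
have edgesE e : (e \in edges (G a)) = (e \in edge_list (G a)).
  by rewrite (perm_mem (edge_listP (G a))) mem_enum.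
rewrite edgesE; apply/idP/idP => [/hasP[l _] | eE].
  rewrite !cells_edges !eqb0 !negbK; set e := nth _ _ _ => /and3P[te ue ve].
  have eE : e \in edge_list (G a).
    rewrite /e; have [/mem_nth -> // | le] := ltnP l (size (edge_list (G a))).
    by move: te; rewrite /e nth_default // inE.
  suff -> : [set t; u; v] = e by [].
  apply/eqP; rewrite eqEcard (@hg_three_uniform (G a)) ?edgesE //.
  apply/andP; split.
    by apply/subsetP => z; rewrite !inE -orbA => /or3P[] /eqP->.
  by rewrite -setUA !cardsU1 cards1 !inE negb_or tu tv uv.
set e := [set t; u; v] in eE *; apply/hasP; exists (index e (edge_list (G a))).
  have sz : index e (edge_list (G a)) < size (edge_list (G a)) by rewrite index_mem.
  have n0 : 0 < #|G a| := leq_ltn_trans (leq0n _) (lt t).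
  by rewrite -Er mem_iota /bound size_word; nia.
by rewrite !cells_edges nth_index // /e !inE !eqxx !orbT.
Qed.

(** The number of vertices is the number of cells that end a prefix of non-null
    cells. *)
Lemma computable_order C : comp (fun a : C => #|G (root a)|).
Proof.
apply: (@eq_computable _ _ _ _ (fun a : C => \sum_(0 <= i < bound (root a))
  all (fun j => ~~ (j <= i) || (0 < cells (root a) j)) (iota 0 (bound (root a))))).
  move=> a; move: (root a) => {}a; have nN := order_lt_bound a.
  transitivity (\sum_(0 <= i < bound a) (i < #|G a|)); last first.
    have nN' : #|G a| <= bound a by lia.
    rewrite -big_mkcond /= -(big_nat_widen 0 _ _ xpredT _ nN') /=.
    by rewrite sum_nat_const_nat subn0 muln1.
  apply: eq_big_nat => i /andP[_ iN].
  congr nat_of_bool; apply/allP/idP => [read | ilt j _].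
    have n_in : #|G a| \in iota 0 (bound a) by rewrite mem_iota; lia.
    rewrite ltnNge; apply/negP => ige; have := read _ n_in.
    by rewrite ige cells_order // ltnn.
  by rewrite -implybE; apply/implyP => ji; rewrite cells_order; lia.
apply: computable_sum; apply: computable_all.
have cj := computable_var cells bound (extend C).
have ci := computable_weaken (computable_var cells bound C).
apply: computable_orb; first by apply: computable_negb; apply: computable_leq.
by apply: computable_leq; [apply: computable_const | apply: computable_load].
Qed.

Lemma computable_edge_at C (f g h : C -> nat) : comp f -> comp g -> comp h ->
  comp (fun a : C => edge_at (root a) (f a) (g a) (h a)).
Proof.
move=> cf cg ch.
have clt (k : C -> nat) : comp k -> comp (fun a => k a < #|G (root a)|).
  by move=> ck; apply: computable_leq (computable_order _); apply: computable_succ.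
have cne (k l : C -> nat) : comp k -> comp l -> comp (fun a => k a != l a).
  by move=> ck cl; apply: computable_negb; apply: computable_eqn.
do 3!(apply: computable_andb; first exact: clt).
do 3!(apply: computable_andb; first exact: cne).
have n_le a : #|G a| <= bound a by have := order_lt_bound a; lia.
apply: computable_has.
have co : comp (fun a : extend C =>
    #|G (root a)|.+1 + #|G (root a)| * x + #|G (root a)| * a.2).
  apply: computable_add; last first.
    apply: computable_mul => //; first exact: computable_order.
    exact: computable_var.
  apply: computable_add; first by apply: computable_succ; apply: computable_order.
  apply: computable_mul => //; first exact: computable_order.
  exact: computable_const.
have cread (k : C -> nat) : comp k -> comp (fun a : extend C =>
    cells (root a) (#|G (root a)|.+1 + #|G (root a)| * x
      + #|G (root a)| * a.2 + k a.1) != 0).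
  move=> ck; apply: computable_negb; apply: computable_eqn; last exact: computable_const.
  by apply: computable_load; apply: computable_add => //; apply: computable_weaken.
apply: computable_andb; first exact: cread.
by apply: computable_andb; apply: cread.
Qed.

End Reading.

(** * The three problems *)

Lemma word_singleton N (b : bool) : 0 < N -> word N (fun y => (y == 0) && b) = b.
Proof.
case: N => // N _; elim: N => [|N IH].
  by rewrite wordS /word big_geq // muln1.
by rewrite wordS IH addn0.
Qed.

Lemma iff_yes_no (A B : Prop) u : (A <-> B) -> yes_no A u -> yes_no B u.
Proof. by move=> AB [b [-> bA]]; exists b; split=> //; rewrite bA. Qed.

Section Solving.

Variables (s x : nat) (P : problem) (valid : instance P -> Prop).
Let A := valid_instance valid.
Variables (G : A -> input3) (extra : A -> seq bool).
Hypothesis encodeE : forall a : A,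
  encode (sval a) = encode_order (G a) ++ extra a ++ encode_edges (G a).
Hypothesis size_extra : forall a, size (extra a) = #|G a| * x.
Hypothesis G_valid : forall a, linear_hg (G a) /\ matching_free s (G a).

Let w (a : A) : seq bool := encode (sval a).
Let k := transversal_bound s.
Let E := edge_at G w x.

(** This covers both colouring problems: [preG] tells which colours are
    prescribed, if any, and [pre] reads them from the input. *)
Lemma poly_time_solvable_extension (pre : A -> bool -> pred nat)
    (preG : forall a, bool -> pred (G a)) :
  (forall (C : ctx A) b (f : C -> nat),
     computable (@input_cells P valid) (@input_bound P valid) f ->
     computable (@input_cells P valid) (@input_bound P valid)
       (fun a => pre (root a) b (f a))) ->
  (forall a b v, pre a b (index v (vertex_list (G a))) = preG a b v) ->
  (forall a u, yes_no (exists2 c : G a -> bool, two_coloring c &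
      forall b v, preG a b v -> c v = b) u -> answer (sval a) u) ->
  poly_time_solvable valid.
Proof.
move=> comp_pre preP ansP.
pose ext a := extendable k (input_bound a) #|G a| (E a) (pre a).
apply: (@poly_time_solvable_of_computable _ _ (fun a => ext a) (fun=> 1)
          (fun a y => (y == 0) && ext a)) => //.
- apply: (@computable_extendable _ _ _ (fun a => #|G a|) E pre _ _ _ (input_ctx valid)).
  + exact: (computable_order encodeE size_extra).
  + exact: (computable_edge_at encodeE size_extra).
  + exact: comp_pre.
- exact: computable_const.
- by move=> a; rewrite word_singleton.
move=> a; apply: ansP; exists (ext a); split=> //.
have [Glin Gfree] := G_valid a.
have [T Tk hitT] := small_transversal (@hg_three_uniform (G a)) Glin Gfree.
apply: (extendableP (@hg_three_uniform (G a)) (vertex_listP (G a)) _ _ _ _ Tk hitT).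
- exact: (order_lt_bound encodeE size_extra).
- exact: (edge_at_triple encodeE size_extra).
- exact: edge_at_lt.
- exact: preP.
Qed.

Lemma poly_time_solvable_max_stable :
  (forall a u, (exists2 S : {set G a}, max_stable S & u = encode_set S) ->
     answer (sval a) u) ->
  poly_time_solvable valid.
Proof.
move=> ansP.
pose code a := best k (input_bound a) #|G a| (E a).
have codeP a : exists t : seq nat, code a =
      (word (input_bound a) (fun v => (v < #|G a|) && (v \notin t))).+1 /\
    max_stable [set v | index v (vertex_list (G a)) \notin t].
  have [Glin Gfree] := G_valid a.
  have [T Tk hitT] := small_transversal (@hg_three_uniform (G a)) Glin Gfree.
  have bound_gt := order_lt_bound encodeE size_extra a.
  have EP := edge_at_triple encodeE size_extra (a := a).
  have E_lt := @edge_at_lt _ G w x a.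
  have [|t [cov best_t tmin]] := @best_neq0 _ _ _ _ (@hg_three_uniform (G a)) (vertex_listP (G a)) bound_gt EP E_lt k.
    apply/eqP => /(best_eq0 (@hg_three_uniform (G a)) (vertex_listP (G a)) bound_gt EP E_lt hitT).
    by rewrite ltnNge Tk.
  exists t; split; first exact: best_t.
  by apply: (covers_max_stable (@hg_three_uniform (G a)) (vertex_listP (G a)) bound_gt EP E_lt).
pose out a y := bit (input_bound a) (code a).-1 y.
apply: (@poly_time_solvable_of_computable _ _ (fun a => code a - 1) (fun a => #|G a|) out).
- apply: computable_sub; last exact: computable_const.
  apply: (@computable_best _ _ _ (fun a => #|G a|) E _ _ (input_ctx valid)).
  + exact: (computable_order encodeE size_extra).
  + exact: (computable_edge_at encodeE size_extra).
- exact: (computable_order encodeE size_extra).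
- move=> a; have [t [e _]] := codeP a; rewrite /out e subn1 /=.
  by apply: eq_word => y yN; rewrite bit_word.
- by move=> a; have := order_lt_bound encodeE size_extra a; rewrite /input_bound; lia.
move=> a; apply: ansP; have [t [e tmax]] := codeP a.
exists [set v | index v (vertex_list (G a)) \notin t] => //.
have sizeG := size_numbering (vertex_listP (G a)).
apply: (@eq_from_nth _ false); first by rewrite size_mkseq size_encode_set.
rewrite size_mkseq => i ilt; have bound_gt := order_lt_bound encodeE size_extra a.
rewrite nth_mkseq // /out e /= bit_word; last by rewrite /input_bound; lia.
have [v <-] := idx_surj (vertex_listP (G a)) ilt.
have vin := mem_numbering (vertex_listP (G a)) v.
rewrite /encode_set (nth_map v) ?index_mem // nth_index // inE.
by rewrite (idx_lt (vertex_listP (G a))).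
Qed.

End Solving.

Theorem theorem1p10 (s : nat) :
  [/\ poly_time_solvable (P := coloring_problem)
        (fun G : input3 => linear_hg G /\ matching_free s G),
      poly_time_solvable (P := precoloring_problem)
        (fun G : precolored_input3 => linear_hg G /\ matching_free s G)
    & poly_time_solvable (P := max_stable_set_problem)
        (fun G : input3 => linear_hg G /\ matching_free s G)].
Proof.
split.
- apply: (@poly_time_solvable_extension s 0 coloring_problem _
    (fun a => sval a) (fun=> [::]) _ _ _ (fun _ _ _ => false) (fun _ _ _ => false)) => //.
  + by move=> a; rewrite muln0.
  + by case.
  + by move=> *; apply: computable_const 0.
  move=> a u; apply: iff_yes_no; split=> [[c col _] | [c col]]; first by exists c.
  by exists c.
- pose A := valid_instance (P := precoloring_problem)
    (fun G : precolored_input3 => linear_hg G /\ matching_free s G).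
  pose G (a : A) : input3 := input (sval a).
  pose X a : {set G a} := precolored (sval a).
  pose Y a : {set G a} := [set val y | y in @precoloring (sval a)].
  pose extra a := encode_set (X a) ++ encode_set (Y a).
  pose cells (a : A) i : nat := nth false (encode (p := precoloring_problem) (sval a)) i.
  (* The first word of [extra] tells which vertices are coloured, and the second
     one which of them have colour [true]. *)
  pose pre a b i := (cells a (#|G a|.+1 + i) != 0) &&
    (if b then cells a (#|G a|.+1 + (#|G a| + i)) != 0
     else cells a (#|G a|.+1 + (#|G a| + i)) == 0).
  pose preG a b (v : G a) := (v \in X a) && ((v \in Y a) == b).
  have encodeE a : encode (p := precoloring_problem) (sval a)
      = encode_order (G a) ++ extra a ++ encode_edges (G a).
    by rewrite /extra -catA.
  have size_extra a : size (extra a) = #|G a| * 2.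
    by rewrite size_cat !size_encode_set muln2 addnn.
  apply: (@poly_time_solvable_extension s 2 precoloring_problem _ G extra
    encodeE size_extra _ pre preG).
  + by case.
  + move=> C b f cf.
    have cn := computable_order encodeE size_extra C.
    have c1 := computable_load (computable_add (computable_succ cn) cf).
    have c2 := computable_load (computable_add (computable_succ cn) (computable_add cn cf)).
    have {}c1 := computable_eqn c1 (computable_const _ _ _ 0).
    have {}c2 := computable_eqn c2 (computable_const _ _ _ 0).
    apply: computable_andb (computable_negb c1) _.
    by case: b; [exact: (computable_negb c2) | exact: c2].
  + move=> a b v; have vlt := idx_lt (vertex_listP (G a)) v.
    have vin := mem_numbering (vertex_listP (G a)) v.
    have read (S : {set G a}) :
        nth false (encode_set S) (index v (vertex_list (G a))) = (v \in S).
      by rewrite /encode_set (nth_map v) ?index_mem // nth_index.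
    rewrite /pre /preG /cells !(cells_extra encodeE size_extra); try lia.
    rewrite !nth_cat !size_encode_set vlt ltnNge leq_addr /= addKn !read.
    by case: b; rewrite !eqb0 negbK // ?eqb_id // ; case: (v \in Y a).
  move=> a u; apply: iff_yes_no; split=> [[c col precol] | [c col ext]].
    exists c => // y; apply: precol; rewrite /preG (valP y) /=; apply/eqP.
    apply/imsetP/idP => [[z zc /val_inj ->] // | yc]; by exists y.
  exists c => // b v /andP[vX /eqP <-].
  have -> : v = val (Sub v vX : induced (X a)) by [].
  rewrite ext; apply/idP/imsetP => [yc | [z zc /val_inj ->] //].
  by exists (Sub v vX).
- apply: (@poly_time_solvable_max_stable s 0 max_stable_set_problem _
    (fun a => sval a) (fun=> [::])) => //.
  + by move=> a; rewrite muln0.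
  + by case.
Qed.
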